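(* Suppose that $f$ is a transcendental entire function and that $f(0)=0$. Let $R_A$ be the function defined on $\mathbb C$ by $$R_A(z)=\begin{cases}\max\{R: z\in A_R(f)\}, & z\in A(f),\\ R_f, & z\notin A(f).\end{cases}$$ Then the function $v=-\log R_A$ is subharmonic in $F(f)$.
   Context: The Fatou set $F(f)$ is the set of points $z\in\mathbb C$ such that $(f^n)_{n\in\mathbb N}$ is a normal family in a neighbourhood of $z$, where $f^n$ denotes the $n$-th iterate of $f$. $M(r)=\max_{|z|=r}|f(z)|$ for $r\ge 0$, and $M^n(r)$ denotes the $n$-th iterate of $r\mapsto M(r)$. For $R>0$ such that $M^n(R)\to\infty$ as $n\to\infty$ (a restriction on $R$ assumed whenever $A_R(f)$ is written), $$A_R(f)=\{z:|f^n(z)|\ge M^n(R),\ n\in\mathbb N\}.$$ The fast escaping set is $$A(f)=\{z: \text{there exists }\ell\in\mathbb N\text{ such that }|f^{n+\ell}(z)|\ge M^n(R),\ \text{for } n\in\mathbb N\},$$ where $R>0$ is such that $M^n(R)\to\infty$ as $n\to\infty$ (the set does not depend on the choice of such $R$). With $f(0)=0$, define $$R_f=\max\{r\ge0: M^n(r)\nrightarrow\infty\text{ as }n\to\infty\}.$$ Then $A(f)=\bigcup_{R>R_f}A_R(f)$, and the maximum in the definition of $R_A(z)$ exists for every $z\in A(f)$.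
   Formalization: When R_f = 0 (e.g. f(z) = z e^z), v = -log 0 = +∞ at points of F(f) outside A(f); so v is shown to be subharmonic on the part of F(f) where v < +∞, this part and the part where v = +∞ both being open. If v < +∞ on F(f), e.g. if R_f > 0, this is the usual claim. *)

(* Defs.v *)
From HB Require Import structures.
From mathcomp Require Import all_boot all_order all_algebra.
From mathcomp Require Import complex.
From mathcomp Require Import all_classical all_reals all_analysis.

Set Implicit Arguments.
Unset Strict Implicit.
Unset Printing Implicit Defensive.

Import Order.TTheory GRing.Theory Num.Theory.
Import numFieldNormedType.Exports.

Local Open Scope classical_set_scope.
Local Open Scope ring_scope.
Local Open Scope complex_scope.

(* The complex plane, as a normed space over itself ([R[i]] alone carries no
   topology): derivability in the direction [1] is then complex
   differentiability. *)
Notation CC R := (R[i]^o).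

(* MathComp's norm on [CC R] takes its values in [R[i]]; [cmod] is the same
   modulus, valued in [R]. *)
Definition cmod (R : realType) (z : CC R) : R := ComplexField.Normc.normc z.

(* The maximum of [S], with junk value [0] if [S] has no greatest element. *)
Definition set_max (R : realType) (S : set R) : R :=
  xget 0 (S `&` ubound S).

Definition entire (R : realType) (f : CC R -> CC R) : Prop :=
  forall z : CC R, derivable f z 1.

Definition transcendental_entire (R : realType) (f : CC R -> CC R) : Prop :=
  entire f /\ ~ exists p : {poly R[i]}, forall z, f z = p.[z].

(* The Riemann sphere is [option (CC R)], with [None] the point at infinity. *)
Definition chordal (R : realType) (p q : option (CC R)) : R :=
  match p, q with
  | Some z, Some w =>
      2 * cmod (z - w)
        / (Num.sqrt (1 + cmod z ^+ 2) * Num.sqrt (1 + cmod w ^+ 2))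
  | Some z, None | None, Some z => 2 / Num.sqrt (1 + cmod z ^+ 2)
  | None, None => 0
  end.

Definition locally_uniform_cvg (R : realType) (U : set (CC R))
    (g : nat -> CC R -> CC R) (h : CC R -> option (CC R)) : Prop :=
  forall z, U z -> exists V : set (CC R), nbhs z V /\
    forall e : R, 0 < e ->
      \forall n \near \oo, forall w, U w -> V w ->
        chordal (Some (g n w)) (h w) < e.

(* Normality in the sense of Montel, with respect to the spherical metric: in
   particular locally uniform convergence to infinity is allowed. *)
Definition normal_family (R : realType) (U : set (CC R))
    (F : set (CC R -> CC R)) : Prop :=
  forall g : nat -> CC R -> CC R, (forall n, F (g n)) ->
    exists k : nat -> nat, {homo k : m n / (m < n)%N} /\
      exists h : CC R -> option (CC R),
        locally_uniform_cvg U (fun n => g (k n)) h.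

Definition fatou_set (R : realType) (f : CC R -> CC R) : set (CC R) :=
  [set z | exists U : set (CC R), [/\ open U, U z &
    normal_family U [set g | exists n : nat, g = iter n f]]].

Definition maxmod (R : realType) (f : CC R -> CC R) (r : R) : R :=
  set_max [set cmod (f z) | z in [set z | cmod z = r]].

Definition maxmod_to_infty (R : realType) (f : CC R -> CC R) (r : R) : Prop :=
  (fun n => iter n (maxmod f) r) @ \oo --> +oo.

Definition admissible (R : realType) (f : CC R -> CC R) (r : R) : Prop :=
  0 < r /\ maxmod_to_infty f r.

(* The set A_r(f); meaningful for [admissible f r]. *)
Definition fast_level (R : realType) (f : CC R -> CC R) (r : R) : set (CC R) :=
  [set z | forall n : nat, iter n (maxmod f) r <= cmod (iter n f z)].

Definition fast_escaping (R : realType) (f : CC R -> CC R) : set (CC R) :=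
  [set z | exists r : R, admissible f r /\
    exists l : nat, forall n : nat,
      iter n (maxmod f) r <= cmod (iter (n + l) f z)].

Definition R_f (R : realType) (f : CC R -> CC R) : R :=
  set_max [set r : R | 0 <= r /\ ~ maxmod_to_infty f r].

Definition R_A (R : realType) (f : CC R -> CC R) (z : CC R) : R :=
  if `[< fast_escaping f z >]
  then set_max [set r : R | admissible f r /\ fast_level f r z]
  else R_f f.

(* Lebesgue mean of [u] over the circle of centre [z] and radius [r]. *)
Definition circle_mean (R : realType) (u : CC R -> \bar R) (z : CC R) (r : R)
    : \bar R :=
  (((2 * pi)^-1)%:E *
   \int[lebesgue_measure]_(t in `[0%R, (2 * pi)%R])
     u (z + ((r * cos t) +i* (r * sin t)))%R)%E.

(* The usual notion: [u] maps the open set [U] to [-oo, +oo), is upper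
   semicontinuous there and satisfies the local submean inequality. *)
Definition subharmonic (R : realType) (U : set (CC R)) (u : CC R -> \bar R)
    : Prop :=
  [/\ open U,
      forall z, U z -> (u z < +oo)%E,
      forall z, U z -> forall a : R, (u z < a%:E)%E ->
        \forall w \near z, (u w < a%:E)%E &
      forall z, U z -> exists rho : R, 0 < rho /\
        forall r : R, 0 < r < rho -> (u z <= circle_mean u z r)%E].

(* Subharmonicity for functions that may be identically +oo on some connected
   components of [U].  The two sets below are disjoint open sets covering [U],
   hence on each component of [U] the function is subharmonic or identically
   +oo.  This is needed for -log R_A, which is +oo where R_A = 0: for instance
   f(z) = e^(2 i pi a) z e^z with a suitable irrational a has a Siegel disc
   around 0, on which R_A = R_f = 0. *)
Definition subharmonic_or_infty (R : realType) (U : set (CC R))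
    (u : CC R -> \bar R) : Prop :=
  open (U `&` [set z | u z = +oo%E]) /\
  subharmonic (U `&` [set z | (u z < +oo)%E]) u.

Lemma subharmonic_or_inftyP (R : realType) (U : set (CC R))
    (u : CC R -> \bar R) :
  (forall z, U z -> (u z < +oo)%E) ->
  subharmonic_or_infty U u <-> subharmonic U u.
Proof.
move=> ufin; rewrite /subharmonic_or_infty.
have -> : U `&` [set z | (u z < +oo)%E] = U.
  by apply/seteqP; split => [z []|z Uz] //; split => //; exact: ufin.
have -> : U `&` [set z | u z = +oo%E] = set0.
  by apply/seteqP; split => [z [/ufin + uz]|//]; rewrite /= uz ltxx.
by split => [[]//|?]; split => //; exact: open0.
Qed.

(* [lne] is the extended logarithm, with value -oo at 0. *)
Definition neg_log_R_A (R : realType) (f : CC R -> CC R) (z : CC R) : \bar R :=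
  (- lne (R_A f z)%:E)%E.

(* Main.v *)
(* Write phi(t) = log M(e^t) and tau = log R_A.  By Hadamard's three circles
   theorem phi is convex and increasing, hence so are its iterates phi^n, and
   tau(z) >= t iff phi^n(t) <= log |f^n(z)| for all n.

   Near a point z0 of the Fatou set either no point is fast escaping, so that
   R_A = R_f, or all points lie in one level set A_{exp t1}(f).  Indeed, if w is
   fast escaping and close to z0, then by normality |f^n| > 1 on a fixed disc for
   all large n, and Harnack's inequality for log |f^n| bounds it below by
   log |f^n(w)| / 5; since f is transcendental, phi(5t) >= 5 phi(t) for large t,
   so that phi^n absorbs the factor 5.

   In the second case log |f^n| - phi^n(t1) is a nonnegative harmonic function.
   Harnack's inequality and the convexity of phi^n yield
   tau(w) >= (1 - c) t1 + c tau(z) with c -> 1 as w -> z, so tau is lower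
   semicontinuous.  If m is the mean of tau over a circle about z, Jensen's
   inequality gives phi^n(m) <= mean of phi^n(tau) <= mean of log |f^n|
   = log |f^n(z)| for all n, that is, m <= tau(z).

   Complex analysis is built from Goursat's theorem on rectangles, applied to
   F(z0 + exp(s + it)): by periodicity it yields the mean value property. *)
Require Import Defs.
From HB Require Import structures.
From mathcomp Require Import all_boot all_order all_algebra.
From mathcomp Require Import complex.
From mathcomp Require Import all_classical all_reals all_analysis.
From mathcomp Require Import measurable_realfun.
From mathcomp Require Import ring lra.

Import Order.TTheory GRing.Theory Num.Theory.
Import numFieldNormedType.Exports.
Set Implicit Arguments.
Unset Strict Implicit.
Unset Printing Implicit Defensive.

Local Open Scope classical_set_scope.
Local Open Scope ring_scope.
Local Open Scope complex_scope.

(** The mean value property is proved for functions that are differentiable off the centre and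
    merely continuous at it. The maximum principle therefore applies to difference quotients
    continued by their slope at the base point, and this alone yields Schwarz's lemma, Lipschitz
    bounds and a Liouville theorem for polynomial growth. Normality only supplies a chordal limit of
    a subsequence, with no regularity. Where the limit is infinite, Harnack makes the set open; its
    complement is open too, so infinity spreads along segments, and compactness turns this into a
    uniform bound. The factor 5 is (3d + 2d) / (3d - 2d): Harnack is used on a disc of radius 3d
    about w, at points within 2d of w. [R_A] is a maximum over conditions indexed by all n. Hence
    every lower bound for tau comes from exhibiting a candidate level and testing it for each n, and
    candidates must stay above [R_f]. The common level t1 guarantees this; it also bounds tau from
    below, which makes tau integrable over circles. *)

Section ComplexPlane.
Variable R : realType.
Local Notation C := (CC R).
Implicit Types (z w : C) (f g : C -> C).

(** * Algebra of the modulus and of real and imaginary parts *)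

Lemma cmodE z : `|z| = (cmod z)%:C.
Proof. by []. Qed.

Lemma cmod_ge0 z : 0 <= cmod z.
Proof. by case: z => a b; exact: sqrtr_ge0. Qed.

Lemma cmod0 : cmod (0 : C) = 0.
Proof. exact: ComplexField.Normc.normc0. Qed.

Lemma cmod1 : cmod (1 : C) = 1.
Proof. exact: ComplexField.Normc.normc1. Qed.

Lemma cmod_eq0 z : (cmod z == 0) = (z == 0).
Proof.
apply/eqP/eqP => [/ComplexField.Normc.eq0_normc//|->]; exact: cmod0.
Qed.

Lemma cmod_gt0 z : (0 < cmod z) = (z != 0).
Proof. by rewrite lt_def cmod_eq0 cmod_ge0 andbT. Qed.

Lemma cmodM z w : cmod (z * w) = cmod z * cmod w.
Proof. exact: ComplexField.Normc.normcM. Qed.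

Lemma cmodV z : cmod z^-1 = (cmod z)^-1.
Proof. exact: ComplexField.Normc.normcV. Qed.

Lemma cmodN z : cmod (- z) = cmod z.
Proof. exact: normcN. Qed.

Lemma cmodX z n : cmod (z ^+ n) = cmod z ^+ n.
Proof. by elim: n => [|n IH]; rewrite ?expr0 ?cmod1// !exprS cmodM IH. Qed.

Lemma cmodD z w : cmod (z + w) <= cmod z + cmod w.
Proof. exact: le_normcD. Qed.

Lemma cmodB z w : cmod (z - w) <= cmod z + cmod w.
Proof. by rewrite -[cmod w]cmodN cmodD. Qed.

Lemma cmod_subC z w : cmod (z - w) = cmod (w - z).
Proof. by rewrite -cmodN opprB. Qed.

Lemma cmod_tri z w u : cmod (z - w) <= cmod (z - u) + cmod (u - w).
Proof. by rewrite (_ : z - w = (z - u) + (u - w)) ?cmodD//; ring. Qed.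

Lemma cmod_ler_sub z w : cmod z - cmod w <= cmod (z - w).
Proof. by rewrite lerBlDr (le_trans _ (cmodD _ _))// subrK. Qed.

Lemma complex_ext z w : complex.Re z = complex.Re w ->
  complex.Im z = complex.Im w -> z = w.
Proof. by case: z w => [a b] [c d] /= -> ->. Qed.

Lemma cReD z w : complex.Re (z + w) = complex.Re z + complex.Re w.
Proof. by case: z w => [a b] [c d]. Qed.

Lemma cImD z w : complex.Im (z + w) = complex.Im z + complex.Im w.
Proof. by case: z w => [a b] [c d]. Qed.

Lemma cReN z : complex.Re (- z) = - complex.Re z.
Proof. by case: z => [a b]. Qed.

Lemma cImN z : complex.Im (- z) = - complex.Im z.
Proof. by case: z => [a b]. Qed.

Lemma cReB z w : complex.Re (z - w) = complex.Re z - complex.Re w.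
Proof. by rewrite cReD cReN. Qed.

Lemma cImB z w : complex.Im (z - w) = complex.Im z - complex.Im w.
Proof. by rewrite cImD cImN. Qed.

Lemma cReM z w : complex.Re (z * w) =
  complex.Re z * complex.Re w - complex.Im z * complex.Im w.
Proof. by case: z w => [a b] [c d]. Qed.

Lemma cImM z w : complex.Im (z * w) =
  complex.Re z * complex.Im w + complex.Im z * complex.Re w.
Proof. by case: z w => [a b] [c d]. Qed.

Lemma cmodRe_le z : `|complex.Re z| <= cmod z.
Proof. by have := normc_ge_Re z; rewrite cmodE lecR. Qed.

Lemma ImERe z : complex.Im z = - complex.Re ('i * z).
Proof. by case: z => [a b]; simpc => /=; rewrite ?mul0r ?mul1r ?sub0r ?opprK. Qed.

Lemma cmod_i : cmod ('i : C) = 1.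
Proof.
by rewrite /cmod /ComplexField.Normc.normc /= expr0n /= add0r expr1n sqrtr1.
Qed.

Lemma cmodIm_le z : `|complex.Im z| <= cmod z.
Proof. by rewrite ImERe normrN (le_trans (cmodRe_le _))// cmodM cmod_i mul1r. Qed.

Lemma cmod_Re_sqr z : cmod z ^+ 2 = complex.Re z ^+ 2 + complex.Im z ^+ 2.
Proof.
by case: z => [a b]; rewrite /cmod /= sqr_sqrtr// addr_ge0// sqr_ge0.
Qed.

Lemma cmod_real (x : R) : cmod (x%:C : C) = `|x|.
Proof. by rewrite /cmod /= expr0n /= addr0 sqrtr_sqr. Qed.

Lemma cmod_leReIm z : cmod z <= `|complex.Re z| + `|complex.Im z|.
Proof.
case: z => a b.
have -> : (a +i* b : C) = (a%:C : C) + 'i * (b%:C : C) by simpc.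
apply: (le_trans (cmodD _ _)).
by rewrite cmodM cmod_i mul1r !cmod_real; simpc.
Qed.

(** * Continuity and complex differentiability at a point *)

Lemma nbhs_cmodP z (V : set C) :
  nbhs z V <-> exists2 e : R, 0 < e & forall w, cmod (w - z) < e -> V w.
Proof.
split=> [/nbhs_ballP[[a b]]|[e e0 h]].
  (* The radius of a ball is itself an element of [R[i]]; positivity forces its imaginary part to
     vanish. *)
  rewrite /= /ball_ ltcE /= => /andP[/eqP b0 a0] h; rewrite b0 in h.
  exists a => // w wz; apply: h; rewrite /ball/= cmodE.
  by rewrite cmod_subC (ltcR (cmod _) a).
apply/nbhs_ballP; exists (e%:C) => /=; first by rewrite ltcR.
by move=> w; rewrite /ball/= cmodE ltcR cmod_subC; exact: h.
Qed.

(* Continuity at a point, wrapped in a record so that comparing two instances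
   never unfolds complex arithmetic. *)
Record ccont f z : Prop := Ccont { ccontW : {for z, continuous f} }.

Lemma ccontP f z : ccont f z <->
  forall e : R, 0 < e -> exists2 d : R, 0 < d &
    forall w, cmod (w - z) < d -> cmod (f w - f z) < e.
Proof.
split=> [[h] e e0|h].
  have /h : nbhs (f z) [set w | cmod (w - f z) < e].
    by apply/nbhs_cmodP; exists e.
  by move/nbhs_cmodP.
split=> V /nbhs_cmodP[e e0 H].
have [d d0 hd] := h _ e0.
by apply/nbhs_cmodP; exists d => // w /hd; exact: H.
Qed.

Lemma ccontD f g z : ccont f z -> ccont g z -> ccont (fun w => f w + g w) z.
Proof. by move=> [fc] [gc]; split; exact: (cvgD fc gc). Qed.

Lemma ccontN f z : ccont f z -> ccont (fun w => - f w) z.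
Proof. by move=> [fc]; split; exact: (cvgN fc). Qed.

Lemma ccontM f g z : ccont f z -> ccont g z -> ccont (fun w => f w * g w) z.
Proof. by move=> [fc] [gc]; split; exact: (cvgM fc gc). Qed.

Lemma ccontV f z : f z != 0 -> ccont f z -> ccont (fun w => (f w)^-1) z.
Proof. by move=> f0 [fc]; split; exact: (cvgV f0 fc). Qed.

Lemma ccont_cst (c : C) z : ccont (fun=> c) z.
Proof. by split; exact: cst_continuous. Qed.

Lemma ccont_id z : ccont id z.
Proof. by split => V. Qed.

Lemma ccont_comp f g z : ccont g z -> ccont f (g z) -> ccont (f \o g) z.
Proof. by move=> [gc] [fc]; split; exact: (continuous_comp gc fc). Qed.

Lemma ccont_near f g z :
  (exists2 d : R, 0 < d & forall w, cmod (w - z) < d -> f w = g w) ->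
  ccont f z -> ccont g z.
Proof.
move=> [d d0 fg] /ccontP fc; apply/ccontP => e e0.
have [d1 d10 h1] := fc _ e0.
exists (Num.min d d1); first by rewrite lt_min d0.
move=> w; rewrite lt_min => /andP[wd /h1].
by rewrite !fg// subrr cmod0.
Qed.

(* Caratheodory's form of differentiability: the algebra of derivatives reduces
   to that of continuous functions, and the slope [q] is a continuous quotient. *)
Record cdiff f z : Prop := Cdiff { cdiffW : exists2 q : C -> C, ccont q z &
  forall w, f w = f z + q w * (w - z) }.

Lemma ccont_subr z (c : C) : ccont (fun w => w - c) z.
Proof. exact: (ccontD (ccont_id _) (ccont_cst _ _)). Qed.

Lemma cdiff_cont f z : cdiff f z -> ccont f z.
Proof.
move=> [[q qc qE]]; rewrite (_ : f = fun w => f z + q w * (w - z)); last exact/funext.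
exact: (ccontD (ccont_cst _ _) (ccontM qc (ccont_subr _ _))).
Qed.

Lemma divKC z w (c : C) : w != z -> (w - z)^-1 * c * (w - z) = c.
Proof. by move=> wz; rewrite mulrAC mulVf ?mul1r// subr_eq0. Qed.

Lemma derivable_cdiff f z : derivable f z 1 -> cdiff f z.
Proof.
move=> df; pose q w := if w == z then 'D_1 f z else (w - z)^-1 * (f w - f z).
split; exists q; last first.
  move=> w; rewrite /q; case: eqVneq => [->|wz]; first by rewrite subrr mulr0 addr0.
  by rewrite divKC// addrC subrK.
apply/ccontP => e e0.
have : nbhs ('D_1 f z) [set w | cmod (w - 'D_1 f z) < e].
  by apply/nbhs_cmodP; exists e.
move=> /df; rewrite /= near_simpl /=.
move=> /nbhs_cmodP[d d0 hd].
exists d => // w wd; rewrite {2}/q eqxx /q; case: eqVneq => [_|wz].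
  by rewrite subrr cmod0.
have := hd (w - z); rewrite /= subr0 => /(_ wd).
rewrite subr_eq0 => /(_ wz).
by rewrite /GRing.scale /= mulr1 subrK.
Qed.

Lemma cdiff_cst (c : C) z : cdiff (fun=> c) z.
Proof.
split; exists (fun=> 0); first exact: ccont_cst.
by move=> w; rewrite mul0r addr0.
Qed.

Lemma cdiff_id z : cdiff id z.
Proof.
split; exists (fun=> 1); first exact: ccont_cst.
by move=> w; rewrite mul1r addrC subrK.
Qed.

Lemma cdiffD f g z : cdiff f z -> cdiff g z -> cdiff (fun w => f w + g w) z.
Proof.
move=> [[p pc pE]] [[q qc qE]]; split; exists (fun w => p w + q w).
  exact: (ccontD pc qc).
by move=> w; rewrite pE qE mulrDl addrACA.
Qed.

Lemma cdiffM f g z : cdiff f z -> cdiff g z -> cdiff (fun w => f w * g w) z.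
Proof.
move=> fz gz; have gc := cdiff_cont gz.
case: fz gz => [[p pc pE]] [[q qc qE]].
split; exists (fun w => p w * g w + f z * q w).
  exact: (ccontD (ccontM pc gc) (ccontM (ccont_cst _ _) qc)).
move=> w.
have pE' : f w - f z = p w * (w - z) by rewrite (pE w) addrAC subrr add0r.
have qE' : g w - g z = q w * (w - z) by rewrite (qE w) addrAC subrr add0r.
rewrite mulrDl -mulrA [g w * _]mulrC mulrA -pE' -[f z * q w * _]mulrA -qE'.
by ring.
Qed.

Lemma cdiffN f z : cdiff f z -> cdiff (fun w => - f w) z.
Proof.
move=> [[q qc qE]]; split; exists (fun w => - q w); first exact: (ccontN qc).
by move=> w; rewrite qE opprD mulNr.
Qed.

Lemma cdiffB f g z : cdiff f z -> cdiff g z -> cdiff (fun w => f w - g w) z.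
Proof. by move=> fz gz; exact: (cdiffD fz (cdiffN gz)). Qed.

Lemma cdiffX f z n : cdiff f z -> cdiff (fun w => f w ^+ n) z.
Proof.
move=> fz; elim: n => [|n IH]; first exact: cdiff_cst.
rewrite (_ : (fun _ => _) = fun w => f w * f w ^+ n); first exact: (cdiffM fz IH).
by apply/funext => w; rewrite exprS.
Qed.

Lemma cdiff_sum (I : Type) (s : seq I) (F : I -> C -> C) z :
  (forall i, cdiff (F i) z) -> cdiff (fun w => \sum_(i <- s) F i w) z.
Proof.
move=> h; elim: s => [|i s IH].
  rewrite (_ : (fun _ => _) = fun=> 0); first exact: cdiff_cst.
  by apply/funext => w; rewrite big_nil.
rewrite (_ : (fun _ => _) = fun w => F i w + \sum_(j <- s) F j w).
  exact: (cdiffD (h i) IH).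
by apply/funext => w; rewrite big_cons.
Qed.

Lemma cdiff_comp f g z : cdiff g z -> cdiff f (g z) -> cdiff (f \o g) z.
Proof.
move=> gz [[p pc pE]]; have gc := cdiff_cont gz.
case: gz => [[q qc qE]].
split; exists (fun w => p (g w) * q w).
  exact: (ccontM (ccont_comp gc pc) qc).
by move=> w; rewrite /= pE; congr (_ + _); rewrite {2}qE [g z + _]addrC addrK mulrA.
Qed.

Lemma cdiff_near f g z :
  (exists2 d : R, 0 < d & forall w, cmod (w - z) < d -> f w = g w) ->
  cdiff f z -> cdiff g z.
Proof.
move=> [d d0 fg] [[q qc qE]].
have fgz : f z = g z by apply: fg; rewrite subrr cmod0.
(* The identity in [cdiff] is required at every point, so far from z the slope has to be the plain
   difference quotient of g. *)
split; exists (fun w => if cmod (w - z) < d then q w else (w - z)^-1 * (g w - g z)).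
  by apply: ccont_near qc; exists d => // w ->.
move=> w; case: ifPn => wd; first by rewrite -fg// -fgz qE.
rewrite divKC; first by rewrite addrC subrK.
by apply: contraNneq wd => ->; rewrite subrr cmod0.
Qed.

Lemma cdiffV f z : f z != 0 -> cdiff f z -> cdiff (fun w => (f w)^-1) z.
Proof.
move=> fz0 fz; have fc := cdiff_cont fz; case: fz => [[q qc qE]].
have [d d0 hd] := (ccontP _ _).1 fc _ (etrans (cmod_gt0 _) fz0).
have fw0 w : cmod (w - z) < d -> f w != 0.
  move=> /hd; apply: contraTneq => ->.
  by rewrite sub0r cmodN ltxx.
(* Near z this is the slope of 1/f. Farther away f may vanish, and the difference quotient is formed
   with the default value of the inverse at 0. *)
split; exists (fun w => if cmod (w - z) < d then - q w * (f w * f z)^-1 else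
   (w - z)^-1 * ((f w)^-1 - (f z)^-1)).
  have : ccont (fun w => - q w * (f w * f z)^-1) z.
    apply: (ccontM (ccontN qc)); apply: ccontV; first by rewrite mulf_neq0.
    exact: (ccontM fc (ccont_cst _ _)).
  by apply: ccont_near; exists d => // w ->.
move=> w; case: ifPn => wd.
  have fw := fw0 _ wd.
  have -> : - q w * (f w * f z)^-1 * (w - z) = - (f w - f z) / (f w * f z).
    by rewrite {2}(qE w) (addrC (f z)) addrK mulrAC mulNr.
  rewrite invfM mulNr mulrBl mulrA mulfV// mul1r mulrCA mulfV// mulr1 opprB.
  by rewrite addrC subrK.
rewrite divKC; first by rewrite addrC subrK.
by apply: contraNneq wd => ->; rewrite subrr cmod0.
Qed.

Lemma cdiff_iter f n z : (forall w, cdiff f w) -> cdiff (iter n f) z.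
Proof.
move=> fd; elim: n => [|n IH]; first exact: cdiff_id.
exact: (cdiff_comp IH).
Qed.

Lemma cont_path f (p : R -> C) (x : R) : {for x, continuous p} ->
  ccont f (p x) -> {for x, continuous (fun t => f (p t))}.
Proof. by move=> pc [fc]; exact: (continuous_comp pc fc). Qed.

Lemma contP (u : R -> R) (x : R) : {for x, continuous u} <->
  forall e : R, 0 < e -> exists2 d : R, 0 < d &
    forall t, `|t - x| < d -> `|u t - u x| < e.
Proof.
split=> [uc e e0|h V /nbhs_ballP[e /= e0 hV]].
  have : nbhs (u x) (ball (u x) e) by exact: nbhsx_ballx.
  move=> /uc /nbhs_ballP[d /= d0 hd]; exists d => // t td.
  by rewrite distrC; apply: hd; rewrite /ball/= distrC.
have [d d0 hd] := h _ e0; apply/nbhs_ballP; exists d => // t td.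
by apply: hV; rewrite /ball/= distrC; apply: hd; rewrite distrC.
Qed.

Lemma cont_cplxP (p : R -> C) (x : R) : {for x, continuous p} <->
  forall e : R, 0 < e -> exists2 d : R, 0 < d &
    forall t, `|t - x| < d -> cmod (p t - p x) < e.
Proof.
split=> [pc e e0|h V /nbhs_cmodP[e e0 hV]].
  have : nbhs (p x) [set w | cmod (w - p x) < e] by apply/nbhs_cmodP; exists e.
  move=> /pc /nbhs_ballP[d /= d0 hd]; exists d => // t td.
  by apply: hd; rewrite /ball/= distrC.
have [d d0 hd] := h _ e0; apply/nbhs_ballP; exists d => // t td.
by apply: hV; apply: hd; rewrite distrC.
Qed.

Lemma cont_Re (p : R -> C) (x : R) : {for x, continuous p} ->
  {for x, continuous (fun t => complex.Re (p t))}.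
Proof.
move=> /cont_cplxP pc; apply/contP => e e0; have [d d0 hd] := pc _ e0.
exists d => // t /hd; rewrite -cReB; apply: le_lt_trans; exact: cmodRe_le.
Qed.

Lemma cont_Im (p : R -> C) (x : R) : {for x, continuous p} ->
  {for x, continuous (fun t => complex.Im (p t))}.
Proof.
move=> /cont_cplxP pc; apply/contP => e e0; have [d d0 hd] := pc _ e0.
exists d => // t /hd; rewrite -cImB; apply: le_lt_trans; exact: cmodIm_le.
Qed.

Lemma cont_cplx (u v : R -> R) (x : R) : {for x, continuous u} ->
  {for x, continuous v} -> {for x, continuous (fun t => (u t +i* v t : C))}.
Proof.
move=> /contP uc /contP vc; apply/cont_cplxP => e e0.
have e20 : 0 < e / 2 by lra.
have [d d0 hd] := uc _ e20; have [d1 d10 hd1] := vc _ e20.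
exists (Num.min d d1); first by rewrite lt_min d0.
move=> t; rewrite lt_min => /andP[/hd tu /hd1 tv].
by apply: (le_lt_trans (cmod_leReIm _)); rewrite cReB cImB /= [e]splitr ltrD.
Qed.

Lemma cmod_ler_dist z w : `|cmod z - cmod w| <= cmod (z - w).
Proof.
rewrite ler_norml cmod_ler_sub andbT.
by rewrite lerNl opprB cmod_subC cmod_ler_sub.
Qed.

Lemma cont_cmod (p : R -> C) (x : R) : {for x, continuous p} ->
  {for x, continuous (fun t => cmod (p t))}.
Proof.
move=> /cont_cplxP pc; apply/contP => e e0; have [d d0 hd] := pc _ e0.
exists d => // t /hd; apply: le_lt_trans; exact: cmod_ler_dist.
Qed.

End ComplexPlane.

(** * Integrals of real functions over compact intervals *)

Section IntervalIntegrals.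
Variable R : realType.
Implicit Types (u v : R -> R) (a b : R).

Local Notation intb a b u := (lebesgue_measure.-integrable `[a, b] (EFin \o u)).
Local Notation "'I' a b u" := (\int[lebesgue_measure]_(x in `[a, b]) u x)%R
  (at level 10, a, b, u at level 9).

Lemma cont_integrable a b u :
  (forall x, a <= x <= b -> {for x, continuous u}) -> intb a b u.
Proof.
move=> uc; apply: continuous_compact_integrable; first exact: segment_compact.
apply/continuous_in_subspaceT => x /set_mem /=; rewrite in_itv /=; exact: uc.
Qed.

Lemma int_cst a b (k : R) : a <= b -> I a b (fun=> k) = (b - a) * k.
Proof.
move=> ab; rewrite Rintegral_cst//= lebesgue_measure_itv/= lte_fin.
case: ltP => [_|ba]; first by rewrite -EFinD /= mulrC.
have -> : b = a by apply/eqP; rewrite eq_le ab ba.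
by rewrite subrr mul0r; exact: mulr0.
Qed.

Lemma int_cst_integrable a b (k : R) : intb a b (fun=> k).
Proof. by apply: cont_integrable => x _; exact: cst_continuous. Qed.

Lemma int_near a b u (k eta : R) : a <= b -> intb a b u ->
  (forall x, a <= x <= b -> `|u x - k| <= eta) ->
  `|I a b u - (b - a) * k| <= (b - a) * eta.
Proof.
move=> ab ui h.
rewrite ler_norml lerBrDr lerBlDr -mulrN -!mulrDr -!int_cst//.
apply/andP; split; apply: le_Rintegral => //; try exact: int_cst_integrable.
- move=> x; rewrite /= in_itv /= => /h; rewrite ler_norml => /andP[]; lra.
- move=> x; rewrite /= in_itv /= => /h; rewrite ler_norml => /andP[]; lra.
Qed.

Lemma int_split a b m u : a <= m <= b -> intb a b u ->
  I a b u = I a m u + I m b u.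
Proof.
move=> /andP[am mb] ui.
have := @Rintegral_itvB R u (BLeft a) (BRight b) m ui.
rewrite !bnd_simp => /(_ am mb) h.
rewrite -(@Rintegral_itv_obnd_cbnd R m (BRight b) u); first by rewrite -h addrC subrK.
apply: integrableS ui => // x; rewrite /= !in_itv/= => /andP[mx ->].
by rewrite andbT (le_trans am)// ltW.
Qed.

Lemma intbS a b c d u : intb a b u -> a <= c -> d <= b -> intb c d u.
Proof.
move=> ui ac db; apply: integrableS ui => //.
move=> x; rewrite /= !in_itv/= => /andP[cx xd].
by rewrite (le_trans ac)// (le_trans xd).
Qed.

(** Continuity at the left endpoint keeps u below the midpoint of u(a) and k on a whole interval
    [a, m]. Strictness at that endpoint is all the maximum principle needs: parameter 0 is the
    rightmost point of a circle. *)
Lemma int_lt a b u (k : R) : a < b ->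
  (forall x, a <= x <= b -> {for x, continuous u}) ->
  (forall x, a <= x <= b -> u x <= k) -> u a < k -> I a b u < (b - a) * k.
Proof.
move=> ab uc uk uak.
have ui := cont_integrable uc.
have : nbhs a [set x | u x < (u a + k) / 2].
  have := uc a; rewrite lexx ltW// => /(_ isT) /cvgr_lt; apply; lra.
move=> /nbhs_ballP[d /= d0 hd].
pose m := Num.min b (a + d / 2).
have am : a < m by rewrite lt_min ab ltrDl divr_gt0.
have mb : m <= b by rewrite ge_min lexx.
rewrite (@int_split a b m)//; last by rewrite (ltW am).
have h1 : I a m u <= (m - a) * ((u a + k) / 2).
  rewrite -int_cst ?(ltW am)//; apply: le_Rintegral => //.
  - exact: intbS ui _ _.
  - exact: int_cst_integrable.
  - move=> x; rewrite /= in_itv/= => /andP[ax xm]; apply/ltW/hd.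
    have xad : x <= a + d / 2 by rewrite (le_trans xm)// ge_min lexx orbT.
    rewrite /ball/= ler0_norm; [lra|lra].
have h2 : I m b u <= (b - m) * k.
  rewrite -int_cst//; apply: le_Rintegral => //.
  - by apply: intbS ui _ _ => //; exact: ltW.
  - exact: int_cst_integrable.
  - move=> x; rewrite /= in_itv/= => /andP[mx xb]; apply: uk.
    by rewrite xb (le_trans (ltW am)).
have : (m - a) * ((u a + k) / 2) < (m - a) * k.
  rewrite ltr_pM2l ?subr_gt0//; lra.
lra.
Qed.

End IntervalIntegrals.

(** * The complex exponential and its derivative *)

Section ComplexExponential.
Variable R : realType.
Local Notation C := (CC R).
Implicit Types (z w : C) (f g : C -> C).

Lemma cdiff_eps f z (a : C) :
  (forall e : R, 0 < e -> exists2 d : R, 0 < d & forall w, cmod (w - z) < d ->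
    cmod (f w - f z - a * (w - z)) <= e * cmod (w - z)) -> cdiff f z.
Proof.
move=> h; split; exists (fun w => if w == z then a else (w - z)^-1 * (f w - f z)).
  apply/ccontP => e e0; have e20 : 0 < e / 2 by lra.
  have [d d0 hd] := h _ e20; exists d => // w wd.
  rewrite eqxx; case: eqVneq => [_|wz]; first by rewrite subrr cmod0.
  have wz0 : w - z != 0 by rewrite subr_eq0.
  have -> : (w - z)^-1 * (f w - f z) - a =
      (w - z)^-1 * (f w - f z - a * (w - z)).
    by rewrite [in RHS]mulrBr mulrCA mulVf// mulr1.
  rewrite cmodM cmodV ltr_pdivrMl ?cmod_gt0//.
  apply: le_lt_trans (hd _ wd) _; rewrite mulrC ltr_pM2l ?cmod_gt0//; lra.
move=> w; case: eqVneq => [->|wz]; first by rewrite subrr mulr0 addr0.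
by rewrite divKC// addrC subrK.
Qed.

Lemma cdiffP f z : cdiff f z -> exists a : C,
  forall e : R, 0 < e -> exists2 d : R, 0 < d & forall w, cmod (w - z) < d ->
    cmod (f w - f z - a * (w - z)) <= e * cmod (w - z).
Proof.
move=> [[q /ccontP qc qE]]; exists (q z) => e e0.
have [d d0 hd] := qc _ e0; exists d => // w /hd wd.
have -> : f w - f z - q z * (w - z) = (q w - q z) * (w - z).
  by rewrite (qE w) [f z + _]addrC addrK mulrBl.
by rewrite cmodM ler_wpM2r ?cmod_ge0 ?ltW.
Qed.

Lemma is_derive_slope (u : R -> R) (x l : R) : is_derive x 1 u l ->
  forall e : R, 0 < e -> exists2 d : R, 0 < d & forall h, `|h| < d ->
    `|u (x + h) - u x - l * h| <= e * `|h|.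
Proof.
move=> [du <-] e e0.
have : nbhs ('D_1 u x) [set w | `|'D_1 u x - w| < e].
  by apply/nbhs_ballP; exists e.
move=> /du; rewrite /= near_simpl => /nbhs_ballP[d /= d0 hd].
exists d => // h hd'; have [->|h0] := eqVneq h 0.
  by rewrite addr0 subrr mulr0 subrr normr0 mulr0.
have := hd h; rewrite /ball/= sub0r normrN => /(_ hd' h0).
rewrite /GRing.scale /= mulr1 [h + x]addrC => /ltW hh.
have -> : u (x + h) - u x - 'D_1 u x * h =
   - (('D_1 u x - h^-1 * (u (x + h) - u x)) * h) by field.
by rewrite normrN normrM ler_wpM2r.
Qed.

Definition cexp z : C :=
  (expR (complex.Re z) * cos (complex.Im z)) +i*
  (expR (complex.Re z) * sin (complex.Im z)).

Lemma cexpD z w : cexp (z + w) = cexp z * cexp w.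
Proof.
case: z w => [a b] [c d]; rewrite /cexp /= expRD cosD sinD.
by simpc; congr (_ +i* _); ring.
Qed.

Lemma cmod_cexp z : cmod (cexp z) = expR (complex.Re z).
Proof.
rewrite /cmod /cexp /= !exprMn -mulrDr cos2Dsin2 mulr1 sqrtr_sqr.
by rewrite ger0_norm// expR_ge0.
Qed.

Lemma cdiff_cexp z : cdiff cexp z.
Proof.
apply: (@cdiff_eps _ _ (cexp z)) => e0 e00.
(* The remainder at the origin will be at most 10 e |k|, namely 3 e |k| for the real part and 7 e
   |k| for the imaginary part. The second bound on e absorbs the prefactor |exp z|; the first one
   keeps exp x at most 2. *)
pose e := Num.min (1 / 10) (e0 / (10 * expR (complex.Re z))).
have ez := expR_gt0 (complex.Re z).
have e_gt0 : 0 < e by rewrite lt_min !divr_gt0// mulr_gt0.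
have e10 : e <= 1 / 10 by rewrite ge_min lexx.
have ee0 : 10 * e * expR (complex.Re z) <= e0.
  have : e <= e0 / (10 * expR (complex.Re z)) by rewrite ge_min lexx orbT.
  rewrite ler_pdivlMr ?mulr_gt0//; lra.
clearbody e; have [d1 d10 h1] := is_derive_slope (is_derive_expR 0) e_gt0.
have [d2 d20 h2] := is_derive_slope (is_derive_cos 0) e_gt0.
have [d3 d30 h3] := is_derive_slope (is_derive_sin 0) e_gt0.
pose d := Num.min (Num.min d1 d2) (Num.min d3 e).
exists d; first by rewrite !lt_min d10 d20 d30 e_gt0.
move=> w; rewrite !lt_min -andbA => /and4P[wd1 wd2 wd3 wde].
have -> : cexp w = cexp z * cexp (w - z) by rewrite -cexpD addrC subrK.
set k := w - z in wd1 wd2 wd3 wde *.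
have -> : cexp z * cexp k - cexp z - cexp z * k = cexp z * (cexp k - 1 - k).
  by ring.
rewrite cmodM cmod_cexp.
suff : cmod (cexp k - 1 - k) <= 10 * e * cmod k.
  move=> h; apply: le_trans (ler_wpM2l (ltW ez) h) _.
  by rewrite mulrA ler_wpM2r ?cmod_ge0// mulrC.
have kx := cmodRe_le k; have ky := cmodIm_le k.
clearbody k; set K := cmod k in kx ky wd1 wd2 wd3 wde *.
have K0 : 0 <= K := cmod_ge0 k.
apply: (le_trans (cmod_leReIm _)).
rewrite !cReB !cImB /= subr0.
move: (complex.Re k) (complex.Im k) kx ky => x y xK yK.
have {h1} := h1 x (le_lt_trans xK wd1).
have {h2} := h2 y (le_lt_trans yK wd2).
have {h3} := h3 y (le_lt_trans yK wd3).
rewrite !add0r expR0 cos0 sin0 oppr0 mul0r !mul1r ?subr0 ?addr0.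
set E := expR x; set c := cos y; set s := sin y.
have c1 : `|c| <= 1 by rewrite ler_norml cos_geN1 cos_le1.
move=> h3 h2 h1; clearbody K E c s; clear - e_gt0 e10 xK yK c1 h1 h2 h3 wde K0.
have xe : `|x| <= 1 / 10 by lra.
have Ex : `|E - 1| <= `|x| * (1 + e).
  have -> : E - 1 = (E - 1 - x) + x by ring.
  apply: (le_trans (ler_normD _ _)); lra.
have E2 : `|E| <= 2.
  have -> : E = (E - 1) + 1 by ring.
  apply: (le_trans (ler_normD _ _)); rewrite normr1.
  have : `|x| * (1 + e) <= 1 / 10 * 2 by apply: ler_pM => //; lra.
  lra.
have eK0 : 0 <= e * K by rewrite mulr_ge0// ltW.
have eK : e * `|x| <= e * K by rewrite ler_wpM2l// ltW.
have eK' : e * `|y| <= e * K by rewrite ler_wpM2l// ltW.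
have A : `|E * c - 1 - x| <= 3 * (e * K).
  have -> : E * c - 1 - x = (E - 1 - x) * c + (1 + x) * (c - 1) by ring.
  apply: (le_trans (ler_normD _ _)); rewrite !normrM.
  have : `|E - 1 - x| * `|c| <= (e * K) * 1 by apply: ler_pM => //; lra.
  have : `|1 + x| * `|c - 1| <= 2 * (e * K).
    apply: ler_pM => //; last lra.
    by apply: (le_trans (ler_normD _ _)); rewrite normr1; lra.
  lra.
have B : `|E * s - y| <= 7 * (e * K).
  have -> : E * s - y = E * (s - y) + (E - 1) * y by ring.
  apply: (le_trans (ler_normD _ _)); rewrite !normrM.
  have : `|E| * `|s - y| <= 2 * (e * K) by apply: ler_pM => //; lra.
  have : `|E - 1| * `|y| <= (2 * e) * K.
    apply: ler_pM => //; apply: (le_trans Ex).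
    have : `|x| * (1 + e) <= e * 2 by apply: ler_pM => //; lra.
    lra.
  lra.
lra.
Qed.

Lemma cexp_periodic (x y : R) : cexp (x +i* (y + 2 * pi)) = cexp (x +i* y).
Proof. by rewrite /cexp /= (mulr_natl pi 2) sinD2pi cosD2pi. Qed.

End ComplexExponential.

(** * Goursat's theorem on rectangles *)

Section Goursat.
Variable R : realType.
Local Notation C := (CC R).
Implicit Types (f g G : C -> C) (a b c d : R).

Local Notation "'I' a b u" := (\int[lebesgue_measure]_(x in `[a, b]) u x)%R
  (at level 10, a, b, u at level 9).

(** Opposite sides share one integrand, so that for a function of period 2 pi i the horizontal sides
    cancel pointwise, before any integration. *)
Definition hdiff G c d (x : R) : R :=
  complex.Re (G (x +i* c)) - complex.Re (G (x +i* d)).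

Definition vdiff G a b (y : R) : R :=
  complex.Im (G (b +i* y)) - complex.Im (G (a +i* y)).

(* The real part of the integral of [G] over the boundary of [a,b] x [c,d]. *)
Definition rect_int G a b c d : R :=
  I a b (hdiff G c d) - I c d (vdiff G a b).

Definition rect a b c d z := a <= complex.Re z <= b /\ c <= complex.Im z <= d.

Lemma hdiff_cont G a b c d : c <= d -> (forall z, rect a b c d z -> ccont G z) ->
  forall x, a <= x <= b -> {for x, continuous (hdiff G c d)}.
Proof.
move=> cd Gc x xab.
have H y : c <= y <= d -> {for x, continuous (fun x => complex.Re (G (x +i* y)))}.
  move=> ycd; apply: cont_Re; apply: (@cont_path _ G (fun x => x +i* y)).
    by apply: cont_cplx; [exact: id|exact: cst_continuous].
  exact: Gc.
by apply: (continuousB (H c _) (H d _)); rewrite lexx cd.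
Qed.

Lemma vdiff_cont G a b c d : a <= b -> (forall z, rect a b c d z -> ccont G z) ->
  forall y, c <= y <= d -> {for y, continuous (vdiff G a b)}.
Proof.
move=> ab Gc y ycd.
have H x : a <= x <= b -> {for y, continuous (fun y => complex.Im (G (x +i* y)))}.
  move=> xab; apply: cont_Im; apply: (@cont_path _ G (fun y => x +i* y)).
    by apply: cont_cplx; [exact: cst_continuous|exact: id].
  exact: Gc.
by apply: (continuousB (H b _) (H a _)); rewrite lexx ab.
Qed.

Lemma rect_int_hsplit G a m b c d : a <= m <= b -> c <= d ->
  (forall z, rect a b c d z -> ccont G z) ->
  rect_int G a b c d = rect_int G a m c d + rect_int G m b c d.
Proof.
move=> /andP[am mb] cd Gc; have ab := le_trans am mb.
rewrite /rect_int (@int_split _ a b m); last 2 first.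
- by rewrite am mb.
- by apply: cont_integrable; exact: (hdiff_cont cd Gc).
have -> : I c d (vdiff G a b) = I c d (vdiff G a m) + I c d (vdiff G m b).
  rewrite -RintegralD//.
  - by apply: eq_Rintegral => y _; rewrite /vdiff; ring.
  - apply: cont_integrable; apply: (vdiff_cont am) => z [/andP[za zm] zcd].
    by apply: Gc; split=> //; rewrite za (le_trans zm).
  - apply: cont_integrable; apply: (vdiff_cont mb) => z [/andP[za zm] zcd].
    by apply: Gc; split=> //; rewrite zm (le_trans am).
lra.
Qed.

Lemma rect_int_vsplit G a b c m d : a <= b -> c <= m <= d ->
  (forall z, rect a b c d z -> ccont G z) ->
  rect_int G a b c d = rect_int G a b c m + rect_int G a b m d.
Proof.
move=> ab /andP[cm md] Gc; have cd := le_trans cm md.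
rewrite /rect_int (@int_split _ c d m (vdiff G a b)); last 2 first.
- by rewrite cm md.
- by apply: cont_integrable; exact: (vdiff_cont ab Gc).
have -> : I a b (hdiff G c d) = I a b (hdiff G c m) + I a b (hdiff G m d).
  rewrite -RintegralD//.
  - by apply: eq_Rintegral => y _; rewrite /hdiff; ring.
  - apply: cont_integrable; apply: (hdiff_cont cm) => z [zab /andP[za zm]].
    by apply: Gc; split=> //; rewrite za (le_trans zm).
  - apply: cont_integrable; apply: (hdiff_cont md) => z [zab /andP[za zm]].
    by apply: Gc; split=> //; rewrite zm (le_trans cm).
lra.
Qed.

(* For an affine [G] the differences of opposite sides are constant, so no
   integral needs to be computed. *)
Lemma rect_int_small G a b c d (p l : C) (e : R) : a <= b -> c <= d ->
  (forall z, rect a b c d z -> ccont G z) ->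
  rect a b c d p -> 0 <= e ->
  (forall z, rect a b c d z ->
    cmod (G z - G p - l * (z - p)) <= e * cmod (z - p)) ->
  `|rect_int G a b c d| <= 4 * e * ((b - a) + (d - c)) ^+ 2.
Proof.
move=> ab cd Gc pr e0 H; set D := (b - a) + (d - c).
have D0 : 0 <= D by rewrite addr_ge0// subr_ge0.
have zp z : rect a b c d z -> cmod (z - p) <= D.
  move=> [/andP[z1 z2] /andP[z3 z4]].
  case: pr => [/andP[p1 p2] /andP[p3 p4]].
  apply: (le_trans (cmod_leReIm _)); rewrite cReB cImB; apply: lerD.
    by rewrite ler_norml; apply/andP; split; lra.
  by rewrite ler_norml; apply/andP; split; lra.
have {}H z : rect a b c d z -> cmod (G z - G p - l * (z - p)) <= e * D.
  move=> zr; apply: (le_trans (H _ zr)); apply: ler_wpM2l => //; exact: zp.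
pose k := complex.Im l.
have h1 : `|I a b (hdiff G c d) - (b - a) * (k * (d - c))| <=
    (b - a) * (2 * (e * D)).
  apply: int_near => //; first exact: cont_integrable (hdiff_cont cd Gc).
  move=> x xab.
  have r1 : rect a b c d (x +i* c) by split; rewrite /= ?lexx.
  have r2 : rect a b c d (x +i* d) by split; rewrite /= ?lexx ?cd.
  set A := G (x +i* c) - G p - l * (x +i* c - p).
  set B := G (x +i* d) - G p - l * (x +i* d - p).
  have -> : hdiff G c d x - k * (d - c) = complex.Re (A - B).
    rewrite /hdiff -cReB.
    have -> : A - B = G (x +i* c) - G (x +i* d) + l * (0 +i* (d - c)).
      have -> : (0 +i* (d - c) : C) = (x +i* d) - (x +i* c).
        by apply: complex_ext; rewrite ?cReB ?cImB /= ?subrr.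
      by rewrite /A /B; ring.
    by rewrite [in RHS]cReD cReM /= mulr0 sub0r.
  apply: (le_trans (cmodRe_le _)); apply: (le_trans (cmodB _ _)).
  rewrite mulr_natl mulr2n; apply: lerD; exact: H.
have h2 : `|I c d (vdiff G a b) - (d - c) * (k * (b - a))| <=
    (d - c) * (2 * (e * D)).
  apply: int_near => //; first exact: cont_integrable (vdiff_cont ab Gc).
  move=> y ycd.
  have r1 : rect a b c d (b +i* y) by split; rewrite /= ?lexx ?ab.
  have r2 : rect a b c d (a +i* y) by split; rewrite /= ?lexx ?ab.
  set A := G (b +i* y) - G p - l * (b +i* y - p).
  set B := G (a +i* y) - G p - l * (a +i* y - p).
  have -> : vdiff G a b y - k * (b - a) = complex.Im (A - B).
    rewrite /vdiff -cImB.
    have -> : A - B = G (b +i* y) - G (a +i* y) - l * ((b - a) +i* 0).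
      have -> : ((b - a) +i* 0 : C) = (b +i* y) - (a +i* y).
        by apply: complex_ext; rewrite ?cReB ?cImB /= ?subrr.
      by rewrite /A /B; ring.
    by rewrite [in RHS]cImB cImM /= mulr0 add0r.
  apply: (le_trans (cmodIm_le _)); apply: (le_trans (cmodB _ _)).
  rewrite mulr_natl mulr2n; apply: lerD; exact: H.
have -> : rect_int G a b c d =
   (I a b (hdiff G c d) - (b - a) * (k * (d - c))) -
   (I c d (vdiff G a b) - (d - c) * (k * (b - a))).
  by rewrite /rect_int; ring.
apply: (le_trans (ler_normB _ _)); apply: (le_trans (lerD h1 h2)).
have -> : (b - a) * (2 * (e * D)) + (d - c) * (2 * (e * D)) = 2 * (e * D ^+ 2).
  by rewrite /D; ring.
have : 0 <= e * D ^+ 2 by rewrite mulr_ge0// exprn_ge0.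
lra.
Qed.

Lemma rect_int_quarter G x y hx hy (B : R) : 0 <= hx -> 0 <= hy ->
  (forall z, rect x (x + hx + hx) y (y + hy + hy) z -> ccont G z) ->
  4 * B < `|rect_int G x (x + hx + hx) y (y + hy + hy)| ->
  exists x' y', [/\ x <= x', x' + hx <= x + hx + hx, y <= y',
    y' + hy <= y + hy + hy & B < `|rect_int G x' (x' + hx) y' (y' + hy)|].
Proof.
move=> hx0 hy0 Gc.
have x1 : x <= x + hx by rewrite lerDl.
have x2 : x + hx <= x + hx + hx by rewrite lerDl.
have y1 : y <= y + hy by rewrite lerDl.
have y2 : y + hy <= y + hy + hy by rewrite lerDl.
rewrite (@rect_int_hsplit _ x (x + hx)) ?x1 ?(le_trans y1 y2)//.
rewrite (@rect_int_vsplit _ x _ y (y + hy)) ?y1//; last first.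
  by move=> z [/andP[k1 k2] k]; apply: Gc; split; rewrite // k1 (le_trans k2).
rewrite (@rect_int_vsplit _ (x + hx) _ y (y + hy)) ?y1//; last first.
  by move=> z [/andP[k1 k2] k]; apply: Gc; split; rewrite // k2 (le_trans x1).
set I1 := rect_int _ _ _ _ _; set I2 := rect_int _ _ _ _ _.
set I3 := rect_int _ _ _ _ _; set I4 := rect_int _ _ _ _ _ => big.
have [k1|k1] := ltP B `|I1|; first by exists x, y.
have [k2|k2] := ltP B `|I2|; first by exists x, (y + hy).
have [k3|k3] := ltP B `|I3|; first by exists (x + hx), y.
have [k4|k4] := ltP B `|I4|; first by exists (x + hx), (y + hy).
clear - big k1 k2 k3 k4.
have := ler_normD (I1 + I2) (I3 + I4); have := ler_normD I1 I2.
have := ler_normD I3 I4; lra.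
Qed.

Lemma half_pow_small (L eps : R) : 0 < eps -> exists n : nat, L / 2 ^+ n < eps.
Proof.
move=> e0; have [n hn] : exists n : nat, `|L| / eps < n%:R.
  exists (Num.bound (`|L| / eps)); apply: archi_boundP.
  by rewrite divr_ge0// ltW.
exists n; rewrite ltr_pdivrMr ?exprn_gt0//.
apply: (le_lt_trans (ler_norm _)); rewrite mulrC -ltr_pdivrMr//.
apply: (lt_le_trans hn); rewrite -natrX ler_nat ltnW// ltn_expl//.
Qed.

(** The choice of successive rectangles is separated from the integrals. Lower corners increase
    while upper corners decrease, so the supremum of the lower corners lies in every rectangle of
    the chain. *)
Lemma nested_quarters (bad : nat -> R -> R -> Prop) (x0 y0 L1 L2 : R) :
  0 <= L1 -> 0 <= L2 -> bad 0%N x0 y0 ->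
  (forall n x y, bad n x y -> exists2 p : R * R, bad n.+1 p.1 p.2 &
    x <= p.1 <= x + L1 / 2 ^+ n.+1 /\ y <= p.2 <= y + L2 / 2 ^+ n.+1) ->
  exists X Y, forall n, exists x y, [/\ bad n x y,
    x0 <= x, x + L1 / 2 ^+ n <= x0 + L1,
    y0 <= y & y + L2 / 2 ^+ n <= y0 + L2] /\
    (x <= X <= x + L1 / 2 ^+ n /\ y <= Y <= y + L2 / 2 ^+ n).
Proof.
move=> L10 L20 b0 step.
pose T := {n : nat & {p : R * R | bad n p.1 p.2}}.
(* The choice is made total by leaving a pair that is not bad unchanged. *)
have next n (p : R * R) : exists q : R * R, bad n p.1 p.2 -> bad n.+1 q.1 q.2 /\
    (p.1 <= q.1 <= p.1 + L1 / 2 ^+ n.+1 /\ p.2 <= q.2 <= p.2 + L2 / 2 ^+ n.+1).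
  case: (pselect (bad n p.1 p.2)) => [bp|nb]; last by exists p.
  by have [q q1 q2] := step _ _ _ bp; exists q.
pose nx n p := projT1 (cid (next n p)).
have nxP n p := projT2 (cid (next n p)).
pose s := fix s n := if n is m.+1 then nx m (s m) else (x0, y0).
have sb n : bad n (s n).1 (s n).2.
  by elim: n => [//|n IH] /=; have [] := nxP n (s n) IH.
have sx n : (s n).1 <= (s n.+1).1 <= (s n).1 + L1 / 2 ^+ n.+1.
  by have [_ []] := nxP n (s n) (sb n).
have sy n : (s n).2 <= (s n.+1).2 <= (s n).2 + L2 / 2 ^+ n.+1.
  by have [_ []] := nxP n (s n) (sb n).
suff lim (u : nat -> R) (L : R) : 0 <= L ->
    (forall n, u n <= u n.+1 <= u n + L / 2 ^+ n.+1) ->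
    exists X, forall n, [/\ u n <= X <= u n + L / 2 ^+ n,
      u 0%N <= u n & u n + L / 2 ^+ n <= u 0%N + L].
  have [X hX] := lim (fun n => (s n).1) _ L10 sx.
  have [Y hY] := lim (fun n => (s n).2) _ L20 sy.
  exists X, Y => n; exists (s n).1, (s n).2.
  have [X1 X2 X3] := hX n; have [Y1 Y2 Y3] := hY n.
  by split; split.
move=> L0 hu.
have half n : L / 2 ^+ n = L / 2 ^+ n.+1 + L / 2 ^+ n.+1.
  by rewrite exprS; field.
have um m n : (m <= n)%N -> u m <= u n /\ u n + L / 2 ^+ n <= u m + L / 2 ^+ m.
  elim: n => [|n IH]; first by rewrite leqn0 => /eqP ->.
  rewrite leq_eqVlt => /predU1P[->//|]; rewrite ltnS => /IH[h1 h2].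
  have /andP[h3 h4] := hu n; have := half n.
  by clear - h1 h2 h3 h4; split; lra.
pose A := [set u n | n in [set: nat]].
have p0 n : 0 <= L / 2 ^+ n by rewrite divr_ge0// exprn_ge0.
have ub n : ubound A (u n + L / 2 ^+ n).
  move=> _ [m _ <-]; have [mn|nm] := leqP m n.
    have [h1 h2] := um _ _ mn; have := p0 n; lra.
  have [h1 h2] := um _ _ (ltnW nm); have := p0 m; lra.
have As : has_sup A.
  by split; [exists (u 0%N); exists 0%N|exists (u 0%N + L / 2 ^+ 0); exact: ub].
exists (sup A) => n; split.
- apply/andP; split; first by apply: (ub_le_sup As.2); exists n.
  by apply: ge_sup (As.1) _; exact: ub.
- by have [] := um _ _ (leq0n n).
- by have [_] := um _ _ (leq0n n); rewrite expr0 divr1.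
Qed.

Lemma goursat G a b c d : a <= b -> c <= d ->
  (forall z, rect a b c d z -> cdiff G z) -> rect_int G a b c d = 0.
Proof.
move=> ab cd Gd; have Gc z (zr : rect a b c d z) := cdiff_cont (Gd z zr).
pose L1 := b - a; pose L2 := d - c.
have L10 : 0 <= L1 by rewrite subr_ge0.
have L20 : 0 <= L2 by rewrite subr_ge0.
apply/eqP; rewrite -normr_eq0; apply/eqP/le_anti; rewrite normr_ge0 andbT.
apply/ler_addgt0Pr => eps eps0; rewrite add0r leNgt; apply/negP => bad0.
(* This makes 4 e (L1 + L2)^2 smaller than eps, so the original rectangle is bad; the summand 1
   keeps the denominator positive for a degenerate rectangle. *)
pose e := eps / (4 * (L1 + L2) ^+ 2 + 1).
have den0 : 0 < 4 * (L1 + L2) ^+ 2 + 1.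
  by rewrite ltr_wpDl// mulr_ge0// exprn_ge0// addr_ge0.
have e0 : 0 < e by rewrite divr_gt0.
pose w n : R := 2 ^+ n.
have w0 n : 0 < w n by rewrite exprn_gt0.
have wS n : w n.+1 = 2 * w n by rewrite /w exprS.
pose badr n x y := [/\ a <= x, x + L1 / w n <= b, c <= y, y + L2 / w n <= d &
  4 * e * ((L1 + L2) / w n) ^+ 2 <
  `|rect_int G x (x + L1 / w n) y (y + L2 / w n)|].
have [] := @nested_quarters badr a c L1 L2 L10 L20.
- have w1 : w 0%N = 1 by rewrite /w expr0.
  have aE : a + L1 / w 0%N = b by rewrite w1 divr1 /L1 addrC subrK.
  have cE : c + L2 / w 0%N = d by rewrite w1 divr1 /L2 addrC subrK.
  rewrite /badr aE cE w1 divr1; split; try exact: lexx.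
  apply: le_lt_trans bad0.
  have -> : 4 * e * (L1 + L2) ^+ 2 =
      eps * (4 * (L1 + L2) ^+ 2) / (4 * (L1 + L2) ^+ 2 + 1).
    by rewrite /e; field; rewrite gt_eqF.
  rewrite ler_pdivrMr// ler_pM2l//; lra.
- move=> n x y [ax xb cy yd bd].
  pose hx := L1 / w n.+1; pose hy := L2 / w n.+1.
  have hx0 : 0 <= hx by rewrite divr_ge0// ltW.
  have hy0 : 0 <= hy by rewrite divr_ge0// ltW.
  have hxE : L1 / w n = hx + hx by rewrite /hx wS; field; rewrite gt_eqF.
  have hyE : L2 / w n = hy + hy by rewrite /hy wS; field; rewrite gt_eqF.
  rewrite hxE addrA in xb bd; rewrite hyE addrA in yd bd.
  set B := 4 * e * ((L1 + L2) / w n.+1) ^+ 2.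
  have BE : 4 * e * ((L1 + L2) / w n) ^+ 2 = 4 * B.
    by rewrite /B wS; field; rewrite gt_eqF.
  rewrite BE in bd.
  have Gr z : rect x (x + hx + hx) y (y + hy + hy) z -> ccont G z.
    move=> [/andP[k1 k2] /andP[k3 k4]]; apply: Gc; split.
      by rewrite (le_trans ax)// (le_trans k2).
    by rewrite (le_trans cy)// (le_trans k4).
  have [x' [y' [k1 k2 k3 k4 k5]]] := rect_int_quarter hx0 hy0 Gr bd.
  exists (x', y'); last first.
    by split; rewrite -/(w _) -/hx -/hy;
      [rewrite k1 -(lerD2r hx)|rewrite k3 -(lerD2r hy)].
  split; rewrite // -/hx -/hy.
  - exact: le_trans k1.
  - exact: le_trans xb.
  - exact: le_trans k3.
  - exact: le_trans yd.
move=> X [Y H].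
have pr : rect a b c d (X +i* Y).
  have [x [y [[_ h1 h2 h3 h4] [h5 h6]]]] := H 0%N.
  rewrite expr0 !divr1 in h2 h4 h5 h6.
  by split=> /=; rewrite /L1 /L2 in h2 h4 h5 h6 *; apply/andP; split; lra.
(* Once the rectangles have diameter below [del], the expansion of G at their common point bounds
   the integral by exactly the quantity that badness says it exceeds. *)
have [l hl] := cdiffP (Gd _ pr).
have [del del0 hdel] := hl _ e0.
have [n hn] := half_pow_small (L1 + L2) del0.
have [x [y [[bd h1 h2 h3 h4] [h5 h6]]]] := H n.
rewrite -/(w n) in hn h2 h4 h5 h6.
case: bd => b1 b2 b3 b4; apply/negP; rewrite -leNgt.
have l1 : 0 <= L1 / w n by rewrite divr_ge0// ltW.
have l2 : 0 <= L2 / w n by rewrite divr_ge0// ltW.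
have sub z : rect x (x + L1 / w n) y (y + L2 / w n) z -> rect a b c d z.
  move=> [/andP[k1 k2] /andP[k3 k4]]; split; apply/andP; split.
  - exact: le_trans k1.
  - exact: le_trans k2 b2.
  - exact: le_trans k3.
  - exact: le_trans k4 b4.
have -> : (L1 + L2) / w n =
    (x + L1 / w n - x) + (y + L2 / w n - y) by rewrite mulrDl; ring.
apply: (@rect_int_small _ _ _ _ _ (X +i* Y) l).
- lra.
- lra.
- by move=> z /sub; exact: Gc.
- by [].
- exact: ltW.
move=> z zr; apply: hdel.
apply: le_lt_trans hn; apply: (le_trans (cmod_leReIm _)); rewrite cReB cImB mulrDl.
case: zr => /andP[k1 k2] /andP[k3 k4]; move: h5 h6 => /andP[h5 h5'] /andP[h6 h6'].
by apply: lerD; rewrite /= ler_norml; apply/andP; split;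
  [clear - k1 h5'|clear - k2 h5|clear - k3 h6'|clear - k4 h6]; lra.
Qed.

End Goursat.

(** * Circle means and the mean value property *)

Section CircleMeans.
Variable R : realType.
Local Notation C := (CC R).
Implicit Types (z w : C) (F : C -> C) (u v : C -> R) (r : R).

Definition circ z r (t : R) : C := z + ((r * cos t) +i* (r * sin t)).

Definition cint u z r := lebesgue_measure.-integrable `[0, 2 * pi]
  (EFin \o (fun t => u (circ z r t))).

Definition cmean u z r : R := (2 * pi)^-1 *
  (\int[lebesgue_measure]_(t in `[0%R, (2 * pi)%R]) u (circ z r t))%R.

Lemma cmod_circ z r t : 0 <= r -> cmod (circ z r t - z) = r.
Proof.
move=> r0; rewrite /circ addrC addKr /cmod /= !exprMn -mulrDr cos2Dsin2 mulr1.
by rewrite sqrtr_sqr ger0_norm.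
Qed.

Lemma circ0 z r : circ z r 0 = z + r%:C.
Proof. by rewrite /circ cos0 sin0 mulr1 mulr0. Qed.

Lemma circ_cexp z r t : 0 < r -> circ z r t = z + cexp (ln r +i* t).
Proof. by move=> r0; rewrite /circ /cexp /= lnK. Qed.

Lemma circ_cont z r t : {for t, continuous (circ z r)}.
Proof.
have : {for t, continuous (fun t => ((r * cos t) +i* (r * sin t) : C))}.
  apply: cont_cplx; apply: continuousM; try exact: cst_continuous.
    exact: continuous_cos.
  exact: continuous_sin.
move=> /cont_cplxP h; apply/cont_cplxP => e e0; have [d d0 hd] := h _ e0.
by exists d => // s /hd; rewrite /circ opprD addrACA subrr add0r.
Qed.

Lemma twopi_gt0 : 0 < 2 * pi :> R.
Proof. by rewrite mulr_gt0// pi_gt0. Qed.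

Lemma twopi_ge0 : 0 <= 2 * pi :> R.
Proof. exact: ltW twopi_gt0. Qed.

Lemma cint_cont u z r :
  (forall t, {for t, continuous (fun t => u (circ z r t))}) -> cint u z r.
Proof. by move=> h; apply: cont_integrable => t _; exact: h. Qed.

Lemma cint_Re F z r : 0 <= r -> (forall w, cmod (w - z) = r -> ccont F w) ->
  cint (fun w => complex.Re (F w)) z r.
Proof.
move=> r0 Fc; apply: cint_cont => t; apply: cont_Re; apply: cont_path.
  exact: circ_cont.
by apply: Fc; rewrite cmod_circ.
Qed.

Lemma cmean_cst (k : R) z r : cmean (fun=> k) z r = k.
Proof.
rewrite /cmean int_cst ?twopi_ge0// subr0 mulrA mulVf ?mul1r//.
by rewrite gt_eqF// twopi_gt0.
Qed.

Lemma cint_cst (k : R) z r : cint (fun=> k) z r.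
Proof. exact: int_cst_integrable. Qed.

Lemma cmeanD u v z r : cint u z r -> cint v z r ->
  cmean (fun w => u w + v w) z r = cmean u z r + cmean v z r.
Proof. by move=> ui vi; rewrite /cmean RintegralD// mulrDr. Qed.

Lemma cmeanZ (k : R) u z r : cint u z r ->
  cmean (fun w => k * u w) z r = k * cmean u z r.
Proof. by move=> ui; rewrite /cmean RintegralZl// mulrCA. Qed.

Lemma cintD u v z r : cint u z r -> cint v z r -> cint (fun w => u w + v w) z r.
Proof.
move=> ui vi; rewrite /cint (_ : EFin \o _ =
  ((EFin \o (fun t => u (circ z r t))) \+ (EFin \o (fun t => v (circ z r t))))%E) //.
exact: integrableD.
Qed.

Lemma cintZ (k : R) u z r : cint u z r -> cint (fun w => k * u w) z r.
Proof.
move=> ui; rewrite /cint (_ : EFin \o _ =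
  (fun t => k%:E * (EFin \o (fun t => u (circ z r t))) t)%E) //.
exact: integrableZl.
Qed.

Lemma le_cmean u v z r : 0 <= r -> cint u z r -> cint v z r ->
  (forall w, cmod (w - z) = r -> u w <= v w) -> cmean u z r <= cmean v z r.
Proof.
move=> r0 ui vi h; rewrite /cmean ler_wpM2l ?invr_ge0 ?twopi_ge0//.
by apply: le_Rintegral => // t _; apply: h; rewrite cmod_circ.
Qed.

Lemma cmean_near u (k eta : R) z r : 0 <= r -> cint u z r ->
  (forall w, cmod (w - z) = r -> `|u w - k| <= eta) ->
  `|cmean u z r - k| <= eta.
Proof.
move=> r0 ui h.
rewrite ler_norml lerBrDr lerBlDr -(cmean_cst (- eta + k) z r) -(cmean_cst (eta + k) z r).
by apply/andP; split; apply: le_cmean => //; try exact: cint_cst;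
  move=> w /h; rewrite ler_norml => /andP[]; lra.
Qed.

Lemma cmean_lt u (k : R) z r : 0 <= r ->
  (forall t, {for t, continuous (fun t => u (circ z r t))}) ->
  (forall w, cmod (w - z) = r -> u w <= k) -> u (z + r%:C) < k ->
  cmean u z r < k.
Proof.
move=> r0 uc uk uk0; rewrite /cmean ltr_pdivrMl ?twopi_gt0//.
rewrite -[X in X * k]subr0; apply: int_lt; rewrite ?twopi_gt0//.
- by move=> t _; apply: uk; rewrite cmod_circ.
- by rewrite circ0.
Qed.

Lemma cmean_Re_eq F z r s (rho : R) : 0 < r -> r <= s -> s < rho ->
  (forall w, 0 < cmod (w - z) < rho -> cdiff F w) ->
  cmean (fun w => complex.Re (F w)) z r = cmean (fun w => complex.Re (F w)) z s.
Proof.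
move=> r0 rs srho Fd; have s0 : 0 < s := lt_le_trans r0 rs.
(* The vertical sides of [rect_int] see imaginary parts; the factor i turns these into the real
   parts of F on the two circles. *)
pose G w := 'i * F (z + cexp w).
have Gd w : complex.Re w <= ln s -> cdiff G w.
  move=> ws; apply: cdiffM; first exact: cdiff_cst.
  apply: (@cdiff_comp _ F (fun w => z + cexp w)).
    by apply: cdiffD; [exact: cdiff_cst|exact: cdiff_cexp].
  apply: Fd; rewrite [z + _]addrC addrK cmod_cexp expR_gt0/=.
  by apply: le_lt_trans srho; rewrite -[leRHS]lnK// ler_expR.
have ab : ln r <= ln s by rewrite ler_ln.
have := @goursat R G (ln r) (ln s) 0 (2 * pi) ab twopi_ge0.
have Gr w : rect (ln r) (ln s) 0 (2 * pi) w -> cdiff G w.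
  by move=> [/andP[_ ws] _]; exact: Gd.
move=> /(_ Gr); rewrite /rect_int.
have -> : hdiff G 0 (2 * pi) = fun=> 0.
  apply/funext => x; rewrite /hdiff /G -(add0r (2 * pi)) cexp_periodic.
  by rewrite subrr.
rewrite int_cst// mulr0 sub0r => /eqP; rewrite oppr_eq0 => /eqP h.
have vE y : vdiff G (ln r) (ln s) y =
    complex.Re (F (circ z s y)) + (-1) * complex.Re (F (circ z r y)).
  rewrite /vdiff /G !ImERe !mulrA -!expr2 !sqr_i !mulN1r !cReN !opprK.
  by rewrite !circ_cexp.
have Fc x : 0 < x -> x <= s -> cint (fun w => complex.Re (F w)) z x.
  move=> x0 xs; apply: cint_Re; first exact: ltW.
  by move=> w wx; apply/cdiff_cont/Fd; rewrite wx x0/= (le_lt_trans xs).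
have : cmean (fun w => complex.Re (F w)) z s +
   (-1) * cmean (fun w => complex.Re (F w)) z r = 0.
  rewrite /cmean mulrCA -mulrDr -RintegralZl//; last exact: (Fc r).
  rewrite -RintegralD//; last 2 first.
  - exact: (Fc s).
  - exact: (cintZ (-1) (Fc r _ _)).
  by under eq_Rintegral do rewrite -vE; rewrite h mulr0.
by rewrite mulN1r => /eqP; rewrite subr_eq0 => /eqP <-.
Qed.

(* Differentiability may fail at the centre: this removes the singularities of
   difference quotients. *)
Lemma mean_value F z r (rho : R) : 0 < r < rho -> ccont F z ->
  (forall w, 0 < cmod (w - z) < rho -> cdiff F w) ->
  cmean (fun w => complex.Re (F w)) z r = complex.Re (F z).
Proof.
move=> /andP[r0 rrho] /ccontP Fc Fd.
apply/eqP; rewrite -subr_eq0 -normr_eq0; apply/eqP/le_anti; rewrite normr_ge0 andbT.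
apply/ler_addgt0Pr => eps eps0; rewrite add0r.
have [d d0 hd] := Fc _ eps0.
pose s := Num.min r (d / 2).
have s0 : 0 < s by rewrite lt_min r0 divr_gt0.
have sr : s <= r by rewrite ge_min lexx.
have sd : s < d.
  have : s <= d / 2 by rewrite ge_min lexx orbT.
  lra.
rewrite -(cmean_Re_eq s0 sr rrho Fd).
apply: cmean_near; first exact: ltW.
  apply: cint_Re; first exact: ltW.
  by move=> w ws; apply/cdiff_cont/Fd; rewrite ws s0 (le_lt_trans sr).
move=> w ws; rewrite -cReB; apply: (le_trans (cmodRe_le _)); apply/ltW/hd.
by rewrite ws.
Qed.

End CircleMeans.

(** * The maximum principle on compact sets *)

Section MaximumPrinciple.
Variable R : realType.
Local Notation C := (CC R).
Implicit Types (z w : C) (F : C -> C) (r : R) (K : set C).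

Lemma cont_cmodR F z : ccont F z -> {for z, continuous (fun w => cmod (F w))}.
Proof.
move=> /ccontP Fc V /nbhs_ballP[e /= e0 hV].
have [d d0 hd] := Fc _ e0; apply/nbhs_cmodP; exists d => // w wd.
apply: hV; rewrite /ball/= distrC; apply: le_lt_trans (hd _ wd).
exact: cmod_ler_dist.
Qed.

Lemma cont_ReR z : {for z, continuous (fun w : C => complex.Re w)}.
Proof.
move=> V /nbhs_ballP[e /= e0 hV].
apply/nbhs_cmodP; exists e => // w wd.
apply: hV; rewrite /ball/= -cReB; apply: le_lt_trans wd.
by rewrite cmod_subC cmodRe_le.
Qed.

Lemma cdisk_compact z r : compact [set w : C | cmod (w - z) <= r].
Proof.
pose S := `[complex.Re z - r, complex.Re z + r]%classic `*`
  `[complex.Im z - r, complex.Im z + r]%classic.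
pose j (p : R * R) : C := p.1 +i* p.2.
have jc : continuous j.
  move=> p; apply: (_ : {for p, continuous j}).
  move=> V /nbhs_cmodP[e e0 hV].
  have e20 : 0 < e / 2 by lra.
  exists (ball p.1 (e / 2), ball p.2 (e / 2)).
    by split; exact: nbhsx_ballx.
  move=> [a b] [/= h1 h2]; apply: hV.
  apply: (le_lt_trans (cmod_leReIm _)); rewrite cReB cImB /= [e]splitr.
  by apply: ltrD; rewrite distrC.
have cS : compact (j @` S).
  apply: continuous_compact; first exact/continuous_subspaceT.
  by apply: compact_setX; exact: segment_compact.
apply: (subclosed_compact _ cS).
  have -> : [set w : C | cmod (w - z) <= r] =
      (fun w => cmod (w - z)) @^-1` [set x | x <= r] by [].
  apply: closed_comp; last exact: closed_le.
  by move=> w _; apply: (@cont_cmodR (fun w => w - z)); exact: ccont_subr.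
move=> w /= wr; exists (complex.Re w, complex.Im w); last first.
  by rewrite /j /=; case: w {wr}.
have := cmodRe_le (w - z); have := cmodIm_le (w - z).
rewrite cReB cImB !ler_norml => /andP[h1 h2] /andP[h3 h4].
by split; rewrite /= in_itv/=; apply/andP; split; lra.
Qed.

Lemma cmod_rotate z : exists c : C, cmod c = 1 /\ c * z = (cmod z)%:C.
Proof.
have [->|z0] := eqVneq z 0; first by exists 1; rewrite cmod1 mulr0 cmod0.
exists (z^-1 * (cmod z)%:C); split.
  rewrite cmodM cmodV cmod_real ger0_norm ?cmod_ge0// mulVf//.
  by rewrite cmod_eq0.
by rewrite mulrAC mulVf// mul1r.
Qed.

(** No connectedness is involved: among the points where |F| is maximal on K, take one with largest
    real part. If it is not in B, a small circle about it lies in K and its rightmost point has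
    strictly smaller |F|, which contradicts the mean value property. Only a punctured disc of
    differentiability is asked for, so isolated bad points are allowed. *)
Lemma maximum_principle K (B : set C) F (m : R) : compact K ->
  (forall z, K z -> ccont F z) ->
  (forall z, K z -> B z \/ exists2 rho : R, 0 < rho & forall w,
    0 < cmod (w - z) < rho -> K w /\ cdiff F w) ->
  (forall z, K z -> B z -> cmod (F z) <= m) ->
  forall z, K z -> cmod (F z) <= m.
Proof.
move=> cK Fc Fd Bm z0 Kz0.
have [z1 /set_mem Kz1 z1max] : exists2 c, c \in K &
    forall t, t \in K -> cmod (F t) <= cmod (F c).
  apply: (@compact_EVT_max C R (fun w => cmod (F w)) K) => //; first by exists z0.
  apply/continuous_in_subspaceT => w /set_mem Kw; apply: cont_cmodR; exact: Fc.
pose M := cmod (F z1).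
pose K' := K `&` [set w | M <= cmod (F w)].
have cK' : compact K'.
  (* F is known to be continuous only at points of K, so closedness is replaced by a covering
     argument: near a point of K with |F| < M the condition to be covered is void. *)
  apply/compact_near_coveringP => I G P FG H.
  have /compact_near_coveringP := cK.
  move=> /(_ I G (fun i x => M <= cmod (F x) -> P i x) FG) h.
  have : \near G, K `<=` (fun x => M <= cmod (F x) -> P G x).
    apply: h => x Kx; have [xM|Mx] := ltP (cmod (F x)) M.
      have h : nbhs x [set x' | cmod (F x') < M].
        have : nbhs (cmod (F x)) [set y | y < M] by exact: lt_nbhsl.
        exact: (cont_cmodR (Fc _ Kx)).
      exists ([set x' | cmod (F x') < M], setT); first by split => //; exact: filterT.
      by move=> [y i] [/= yM _]; rewrite leNgt yM.
    by have := H x (conj Kx Mx); apply: filterS => p hp _; exact: hp.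
  by apply: filterS => i hi y [Ky My]; exact: hi.
have [z2 /set_mem[Kz2 z2M] z2max] : exists2 c, c \in K' &
    forall t, t \in K' -> complex.Re t <= complex.Re c.
  apply: (@compact_EVT_max C R (fun w => complex.Re w) K') => //.
    by exists z1; split => //=.
  apply/continuous_in_subspaceT => w _; exact: cont_ReR.
have FM w : K w -> cmod (F w) <= M by move=> Kw; apply: z1max; exact: mem_set.
have [Bz2|[rho rho0 h]] := Fd _ Kz2.
  by apply: le_trans (Bm _ Kz2 Bz2); apply: le_trans z2M; exact: FM.
exfalso.
have Fz2 : cmod (F z2) = M by apply/le_anti; rewrite FM// z2M.
(* A rotation makes the value at [z2] equal to the positive real number M or to 0, so that the mean
   value property for real parts sees the full modulus. *)
have [c [c1 cE]] := cmod_rotate (F z2); rewrite Fz2 in cE.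
pose r := rho / 2.
have r0 : 0 < r by rewrite divr_gt0.
have rr : 0 < r < rho by rewrite r0 /= /r; lra.
pose H w := c * F w.
have Hd w : 0 < cmod (w - z2) < rho -> cdiff H w.
  by move=> wr; apply: cdiffM; [exact: cdiff_cst|exact: (h _ wr).2].
have := mean_value rr (ccontM (ccont_cst c z2) (Fc _ Kz2)) Hd.
have -> : complex.Re (c * F z2) = M.
  by rewrite cE.
have HK w : cmod (w - z2) = r -> K w by move=> wr; apply: (h _ _).1; rewrite wr.
apply/eqP; rewrite lt_eqF//; apply: cmean_lt.
- exact: ltW.
- move=> t; apply: cont_Re; apply: (@cont_path _ H); first exact: circ_cont.
  by apply/cdiff_cont/Hd; rewrite cmod_circ ?(ltW r0).
- move=> w wr; apply: (le_trans (ler_norm _)); apply: (le_trans (cmodRe_le _)).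
  by rewrite cmodM c1 mul1r; apply/FM/HK.
have Kr : K (z2 + r%:C).
  by apply: HK; rewrite [z2 + _]addrC addrK cmod_real ger0_norm// ltW.
apply: (le_lt_trans (ler_norm _)); apply: (le_lt_trans (cmodRe_le _)).
rewrite cmodM c1 mul1r lt_neqAle FM// andbT; apply/negP => /eqP FE.
have : K' (z2 + r%:C) by split => //=; rewrite FE.
move=> /mem_set /z2max; rewrite cReD /=; lra.
Qed.

End MaximumPrinciple.

(** * Schwarz's lemma, Lipschitz bounds and Liouville's theorem *)

Section HolomorphicInequalities.
Variable R : realType.
Local Notation C := (CC R).
Implicit Types (z w : C) (F q g : C -> C) (r rho m : R) (S : seq C).

(** Lets inequalities proved on closed discs of radius r < rho pass to the open disc of radius
    rho. *)
Lemma affine_limit (A B d rho : R) : d < rho ->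
  (forall r, d < r < rho -> 0 <= A * r + B) -> 0 <= A * rho + B.
Proof.
move=> drho h; rewrite leNgt; apply/negP => neg.
(* The first bound keeps rho - t above d, the second keeps A (rho - t) + B negative. *)
pose t := Num.min ((rho - d) / 2) (- (A * rho + B) / (2 * (`|A| + 1))).
have A1 : 0 < `|A| + 1 by rewrite ltr_wpDl.
have t0 : 0 < t by rewrite lt_min !divr_gt0 ?subr_gt0 ?oppr_gt0// mulr_gt0.
have t1 : t <= (rho - d) / 2 by rewrite ge_min lexx.
have t2 : t * (2 * (`|A| + 1)) <= - (A * rho + B).
  by rewrite -ler_pdivlMr ?mulr_gt0// ge_min lexx orbT.
have /h : d < rho - t < rho by apply/andP; split; lra.
have : - A * t <= `|A| * t by rewrite ler_wpM2r ?(ltW t0)// -normrN ler_norm.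
lra.
Qed.

Lemma avoid_finite S z : exists2 rho : R, 0 < rho &
  forall w, 0 < cmod (w - z) < rho -> w \notin S.
Proof.
elim: S => [|s S [rho rho0 h]]; first by exists 1.
have [->|sz] := eqVneq s z.
  exists rho => // w /[dup] /h wS /andP[wz _]; rewrite inE negb_or wS andbT.
  by apply: contraTneq wz => ->; rewrite subrr cmod0 ltxx.
exists (Num.min rho (cmod (s - z))).
  by rewrite lt_min rho0 cmod_gt0 subr_eq0.
move=> w; rewrite lt_min => /and3P[wz wrho ws]; rewrite inE negb_or h ?wz//.
by rewrite andbT; apply: contraTneq ws => ->; rewrite ltxx.
Qed.

(** The finite list S holds the points where F is only continuous, such as the base points of
    difference quotients; the punctured discs in [maximum_principle] avoid them. *)
Lemma max_disk S F z0 r m :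
  (forall w, cmod (w - z0) <= r -> ccont F w) ->
  (forall w, cmod (w - z0) < r -> w \notin S -> cdiff F w) ->
  (forall w, cmod (w - z0) = r -> cmod (F w) <= m) ->
  forall w, cmod (w - z0) <= r -> cmod (F w) <= m.
Proof.
move=> Fc Fd Fm; apply: (@maximum_principle _ _ [set w | cmod (w - z0) = r]).
- exact: cdisk_compact.
- exact: Fc.
- move=> z zr; have [zr'|zr'] := ltP (cmod (z - z0)) r; last first.
    by left; apply/le_anti; rewrite zr zr'.
  right; have [rho rho0 h] := avoid_finite S z.
  exists (Num.min rho (r - cmod (z - z0))); first by rewrite lt_min rho0 subr_gt0.
  move=> w; rewrite lt_min => /and3P[w0 w1 w2].
  have wr : cmod (w - z0) < r by have := cmod_tri w z0 z; lra.
  by split; [exact: ltW|apply: Fd => //; apply: h; rewrite w0].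
- by move=> z _; exact: Fm.
Qed.

Lemma slope_eq F q w0 w : (forall w, F w = F w0 + q w * (w - w0)) -> w != w0 ->
  (F w - F w0) * (w - w0)^-1 = q w.
Proof.
by move=> qE ww0; rewrite (qE w) [F w0 + _]addrC addrK mulfK// subr_eq0.
Qed.

Lemma slope_near F q w0 w1 : (forall w, F w = F w0 + q w * (w - w0)) ->
  w1 != w0 -> exists2 d : R, 0 < d & forall w, cmod (w - w1) < d ->
   (F w - F w0) * (w - w0)^-1 = q w.
Proof.
move=> qE ww0; exists (cmod (w1 - w0)); first by rewrite cmod_gt0 subr_eq0.
move=> w ww; apply: slope_eq => //; apply: contraTneq ww => ->.
by rewrite cmod_subC ltxx.
Qed.

Lemma slope_cont F q w0 w1 : (forall w, F w = F w0 + q w * (w - w0)) ->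
  w1 != w0 -> ccont F w1 -> ccont q w1.
Proof.
move=> qE ww0 Fc; apply: ccont_near (slope_near qE ww0) _.
apply: (ccontM (ccontD Fc (ccont_cst _ _))); apply: ccontV.
  by rewrite subr_eq0.
exact: ccont_subr.
Qed.

Lemma slope_cdiff F q w0 w1 : (forall w, F w = F w0 + q w * (w - w0)) ->
  w1 != w0 -> cdiff F w1 -> cdiff q w1.
Proof.
move=> qE ww0 Fd; apply: cdiff_near (slope_near qE ww0) _.
apply: (cdiffM (cdiffB Fd (cdiff_cst _ _))); apply: cdiffV.
  by rewrite subr_eq0.
exact: (cdiffB (cdiff_id _) (cdiff_cst _ _)).
Qed.

(** The slope of F at z0 is continuous at z0 and differentiable elsewhere, and it is bounded by m /
    r on the circle of radius r. The maximum principle carries this bound inside, and then r tends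
    to rho. *)
Lemma schwarz F z0 rho m : 0 < rho ->
  (forall w, cmod (w - z0) < rho -> cdiff F w) ->
  (forall w, cmod (w - z0) < rho -> cmod (F w - F z0) <= m) ->
  forall w, cmod (w - z0) < rho -> cmod (F w - F z0) * rho <= m * cmod (w - z0).
Proof.
move=> rho0 Fd Fm w1 w1rho; set d := cmod (w1 - z0).
have Fz0 : cdiff F z0 by apply: Fd; rewrite subrr cmod0.
case: (Fz0) => [[q qc qE]].
rewrite -subr_ge0 -opprB oppr_ge0.
suff : 0 <= - cmod (F w1 - F z0) * rho + m * d by lra.
apply: (affine_limit w1rho) => r /andP[dr rrho].
have r0 : 0 < r by apply: le_lt_trans dr; exact: cmod_ge0.
have qm : cmod (q w1) <= m / r.
  apply: (@max_disk [:: z0] q z0 r (m / r)) => [w wr|w wr|w wr|]; last exact: ltW.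
  - have [->//|wz] := eqVneq w z0.
    by apply: slope_cont qE wz _; apply/cdiff_cont/Fd; rewrite (le_lt_trans wr).
  - rewrite inE => wz.
    by apply: slope_cdiff qE wz _; apply/Fd; rewrite (lt_trans wr).
  - have wz : w != z0 by rewrite -subr_eq0 -cmod_eq0 wr gt_eqF.
    rewrite -(slope_eq qE wz) cmodM cmodV wr ler_pM2r ?invr_gt0//.
    by apply: Fm; rewrite wr.
have -> : cmod (F w1 - F z0) = cmod (q w1) * d.
  by rewrite (qE w1) [F z0 + _]addrC addrK cmodM.
have := ler_wpM2r (ltW r0) qm; rewrite divfK ?gt_eqF// => h.
have := ler_wpM2r (cmod_ge0 (w1 - z0)) h; rewrite -/d; lra.
Qed.

(** Schwarz's lemma on the disc of radius rho - r about w2, where F oscillates by at most 2m; for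
    points farther apart the oscillation bound alone suffices. *)
Lemma lipschitz_disk F z0 r rho m : r < rho ->
  (forall w, cmod (w - z0) < rho -> cdiff F w) ->
  (forall w, cmod (w - z0) < rho -> cmod (F w) <= m) ->
  forall w1 w2, cmod (w1 - z0) <= r -> cmod (w2 - z0) <= r ->
  cmod (F w1 - F w2) <= 2 * m / (rho - r) * cmod (w1 - w2).
Proof.
move=> rrho Fd Fm w1 w2 w1r w2r.
have s0 : 0 < rho - r by rewrite subr_gt0.
have Fm2 w w' : cmod (w - z0) < rho -> cmod (w' - z0) < rho ->
    cmod (F w - F w') <= 2 * m.
  move=> h h'; apply: (le_trans (cmodB _ _)); have := Fm _ h; have := Fm _ h'; lra.
have sub w : cmod (w - w2) < rho - r -> cmod (w - z0) < rho.
  by move=> h; have := cmod_tri w z0 w2; lra.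
have w1rho : cmod (w1 - z0) < rho by apply: le_lt_trans rrho.
have w2rho : cmod (w2 - z0) < rho by apply: le_lt_trans rrho.
rewrite mulrAC ler_pdivlMr//.
have [h|h] := ltP (cmod (w1 - w2)) (rho - r).
  by apply: schwarz => // w /sub h'; [exact: Fd|exact: Fm2].
have := Fm2 _ _ w1rho w2rho; set a := cmod (F w1 - F w2) => am.
have a0 : 0 <= a := cmod_ge0 _.
apply: (le_trans (ler_wpM2r (ltW s0) am)).
by apply: ler_wpM2l => //; apply: le_trans am.
Qed.

Lemma exists_notin S : exists w : C, w \notin S.
Proof.
suff [r h] : exists r : R, forall s, s \in S -> cmod s < r.
  exists (`|r|%:C); apply/negP => /h; rewrite cmod_real normr_id.
  by rewrite ltNge ler_norm.
elim: S => [|s S [r h]]; first by exists 0.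
exists (Num.max r (cmod s + 1)) => t; rewrite inE => /predU1P[->|/h tr].
  by rewrite lt_max ltrDl ltr01 orbT.
by rewrite lt_max tr.
Qed.

(** Passing to the slope lowers the order of growth by one at the price of one more exceptional
    point. The base point is taken outside S because a continuous slope requires differentiability
    there. *)
Lemma exists_slope S F : (forall w, ccont F w) ->
  (forall w, w \notin S -> cdiff F w) ->
  exists w0 q, [/\ forall w, F w = F w0 + q w * (w - w0), forall w, ccont q w,
    forall w, w \notin w0 :: S -> cdiff q w &
    forall w r, cmod w = r -> cmod w0 < r ->
      cmod (q w) * (r - cmod w0) <= cmod (F w) + cmod (F w0)].
Proof.
move=> Fc Fd; have [w0 w0S] := exists_notin S; case: (Fd _ w0S) => [[q qc qE]].
exists w0, q; split=> // [w|w|w r wr w0r].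
- have [->//|ww0] := eqVneq w w0; exact: slope_cont qE ww0 (Fc _).
- rewrite inE negb_or => /andP[ww0 wS]; exact: slope_cdiff qE ww0 (Fd _ wS).
- apply: le_trans (cmodB _ _); rewrite (qE w) [F w0 + _]addrC addrK.
  by rewrite cmodM ler_wpM2l ?cmod_ge0// -wr cmod_ler_sub.
Qed.

(** Induction on the degree through slopes; S collects the base points already used. A bound on some
    arbitrarily large circles is enough, since the maximum principle fills in the discs. *)
Lemma liouville_poly (n : nat) S F (k : R) : 0 <= k -> (forall w, ccont F w) ->
  (forall w, w \notin S -> cdiff F w) ->
  (forall r0 : R, exists2 r, r0 < r &
    forall w, cmod w = r -> cmod (F w) <= k * r ^+ n) ->
  exists p : {poly R[i]}, forall z, F z = p.[z].
Proof.
elim: n S F k => [|n IH] S F k k0 Fc Fd Fk;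
  have [w0 [q [qE qcont qd qw]]] := exists_slope Fc Fd.
(* On large circles |q| is at most (k + |F(w0)|) / (r - |w0|), which tends to 0. *)
- suff q0 w : q w = 0.
    by exists (F w0)%:P => z; rewrite hornerC (qE z) q0 mul0r addr0.
  apply/eqP; rewrite -cmod_eq0; apply/eqP/le_anti; rewrite cmod_ge0 andbT.
  apply/ler_addgt0Pr => e e0; rewrite add0r.
  have [r rbig Fr] := Fk (cmod w0 + cmod w + (k + cmod (F w0)) / e).
  have h0 : 0 <= (k + cmod (F w0)) / e.
    by exact: divr_ge0 (addr_ge0 k0 (cmod_ge0 _)) (ltW e0).
  have := cmod_ge0 w0; have := cmod_ge0 w => w_0 w0_0.
  apply: (@max_disk (w0 :: S) q 0 r e) => [w' _|w' _|w'|].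
  + exact: qcont.
  + exact: qd.
  + rewrite subr0 => w'r; have w0r : cmod w0 < r by lra.
    have := qw _ _ w'r w0r; have := Fr _ w'r; rewrite expr0 mulr1 => h1 h2.
    have rw0 : 0 < r - cmod w0 by rewrite subr_gt0.
    rewrite -(ler_pM2r rw0); apply: (le_trans h2).
    have : k + cmod (F w0) <= e * (r - cmod w0).
      rewrite mulrC -ler_pdivrMr//; lra.
    lra.
  + rewrite subr0; lra.
(* For r > 2 |w0| + 1 one has r - |w0| >= r / 2, whence the factor 2, and r^(n+1) >= 1 absorbs the
   constant |F(w0)|. *)
- have [] := IH (w0 :: S) q (2 * (k + cmod (F w0))).
  + by rewrite mulr_ge0// addr_ge0// cmod_ge0.
  + exact: qcont.
  + exact: qd.
  + move=> r0; have [r rbig Fr] := Fk (`|r0| + 2 * cmod w0 + 1).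
    have := cmod_ge0 w0 => w0_0; have := normr_ge0 r0 => r0_0.
    exists r; first by have := ler_norm r0; lra.
    move=> w wr; have w0r : cmod w0 < r by lra.
    have := qw _ _ wr w0r; have := Fr _ wr => h1 h2.
    have rpos : 0 < r by lra.
    have r2 : r / 2 <= r - cmod w0 by lra.
    have rn : 1 <= r ^+ n by rewrite exprn_ege1//; lra.
    have h3 : cmod (q w) * (r / 2) <= cmod (q w) * (r - cmod w0).
      by rewrite ler_wpM2l ?cmod_ge0.
    have h4 : cmod (F w0) <= cmod (F w0) * (r * r ^+ n).
      rewrite ler_peMr ?cmod_ge0// mulr_ege1//; lra.
    have r20 : 0 < r / 2 by lra.
    rewrite -(ler_pM2r r20); rewrite exprS in h1; lra.
  move=> p pE; exists ((F w0)%:P + p * ('X - w0%:P)) => z.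
  by rewrite hornerD hornerM hornerXsubC hornerC (qE z) pE.
Qed.

Lemma cdisk_bounded F z0 r : (forall w, cmod (w - z0) <= r -> ccont F w) ->
  exists m, forall w, cmod (w - z0) <= r -> cmod (F w) <= m.
Proof.
move=> Fc; have [r0|r0] := leP 0 r; last first.
  by exists 0 => w wr; have := cmod_ge0 (w - z0); lra.
have D0 : [set w : C | cmod (w - z0) <= r] !=set0.
  by exists z0; rewrite /= subrr cmod0.
have Fcm := @continuous_in_subspaceT _ _ _ _
  (fun w wr => cont_cmodR (Fc w (set_mem wr))).
have [c _ cmax] := compact_EVT_max D0 (@cdisk_compact _ _ _) Fcm.
by exists (cmod (F c)) => w wr; apply: cmax; exact: mem_set.
Qed.

Lemma cdisk_away0 F z0 r : (forall w, cmod (w - z0) <= r -> ccont F w) ->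
  (forall w, cmod (w - z0) <= r -> F w != 0) ->
  exists2 m, 0 < m & forall w, cmod (w - z0) <= r -> m <= cmod (F w).
Proof.
move=> Fc F0; have [|m hm] := @cdisk_bounded (fun w => (F w)^-1) z0 r.
  by move=> w wr; apply: ccontV; [exact: F0|exact: Fc].
exists (`|m| + 1)^-1; first by rewrite invr_gt0 ltr_wpDl.
move=> w wr; have Fw : 0 < cmod (F w) by rewrite cmod_gt0 F0.
rewrite -[leRHS]invrK lef_pV2 ?posrE ?invr_gt0 ?ltr_wpDl//.
by rewrite -cmodV; have := hm _ wr; have := ler_norm m; lra.
Qed.

End HolomorphicInequalities.

(** * Harmonicity of log |g| for zero-free g, and Harnack's inequality *)

Section LogHarmonic.
Variable R : realType.
Local Notation C := (CC R).
Implicit Types (z w : C) (F q g : C -> C) (r rho m : R).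

Lemma ln_ge_frac (x : R) : -1 < x -> x / (1 + x) <= ln (1 + x).
Proof.
move=> x1; have x0 : 0 < 1 + x by lra.
rewrite -lerN2 -lnV ?posrE//.
have E : (1 + x)^-1 = 1 + (- (x / (1 + x))) by field; rewrite gt_eqF.
rewrite [in leLHS]E; apply: le_ln1Dx; rewrite ltrN2 ltr_pdivrMr//; lra.
Qed.

(** With |1 + z|^2 = 1 + x and x = 2 Re z + t^2, the bounds x - 4 x^2 <= ln (1 + x) <= x are halved.
    The constant is 12 = 25/2 - 1/2, because x^2 <= 25/4 t^2. *)
Lemma ln_cmod1D z : cmod z <= 1 / 2 ->
  `|ln (cmod (1 + z)) - complex.Re z| <= 12 * cmod z ^+ 2.
Proof.
move=> z2; set t := cmod z in z2 *; have t0 : 0 <= t := cmod_ge0 z.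
pose x := 2 * complex.Re z + t ^+ 2.
have hRe := cmodRe_le z; rewrite -/t in hRe.
have tt : t ^+ 2 <= t / 2 by have := ler_wpM2l t0 z2; rewrite expr2; lra.
have xE : cmod (1 + z) ^+ 2 = 1 + x.
  by rewrite cmod_Re_sqr cReD cImD /= /x /t cmod_Re_sqr add0r; ring.
have hR1 : `|x| <= 5 / 2 * t.
  apply: (le_trans (ler_normD _ _)); rewrite normrM normr_nat.
  rewrite (@ger0_norm _ (t ^+ 2)) ?sqr_ge0//; lra.
have x2 : x ^+ 2 <= 25 / 4 * t ^+ 2.
  have : `|x| ^+ 2 <= (5 / 2 * t) ^+ 2 by rewrite lerXn2r ?nnegrE//; lra.
  rewrite real_normK ?num_real//; lra.
have xl : - (3 / 4) <= x.
  have : - t <= complex.Re z by move: hRe; rewrite ler_norml => /andP[].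
  have : (0 : R) <= (t - 1 / 2) * (t - 3 / 2) by rewrite mulr_le0//; lra.
  rewrite /x expr2; lra.
have c0 : 0 < cmod (1 + z).
  rewrite lt_neqAle cmod_ge0 andbT; apply/eqP => h.
  move: xE; rewrite -h expr0n /=; lra.
have lnE : ln (cmod (1 + z)) = ln (1 + x) / 2.
  by rewrite -xE lnXn// mulr2n; lra.
have up : ln (1 + x) <= x by apply: le_ln1Dx; lra.
have lo : x - 4 * x ^+ 2 <= ln (1 + x).
  have x1 : -1 < x by lra.
  apply: le_trans (ln_ge_frac x1); rewrite ler_pdivlMr; last lra.
  have : 0 <= x ^+ 2 * (3 + 4 * x) by rewrite mulr_ge0 ?sqr_ge0//; lra.
  lra.
have xE' : x = 2 * complex.Re z + t ^+ 2 by [].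
by rewrite lnE ler_norml; apply/andP; split; lra.
Qed.

(* The telescoping product of the ratios of [g] along the radius replaces a
   holomorphic logarithm of [g]: each factor is [1 + O(1/N)], so the sum of the
   deviations from 1 is holomorphic and its real part is [O(1/N)]-close to
   [ln |g|]. *)
Lemma log_approx g z0 r rho eps : 0 < r < rho -> 0 < eps ->
  (forall w, cmod (w - z0) < rho -> cdiff g w) ->
  (forall w, cmod (w - z0) < rho -> g w != 0) ->
  exists L : C -> C, [/\ forall w, cmod (w - z0) < r -> cdiff L w, L z0 = 0 &
    forall w, cmod (w - z0) < r ->
      `|ln (cmod (g w)) - ln (cmod (g z0)) - complex.Re (L w)| <= eps].
Proof.
move=> /andP[r0 rrho] eps0 gd g0.
(* On the closed disc of this intermediate radius g is bounded and bounded away from 0, which makes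
   the estimates uniform in w. *)
pose rho' := (r + rho) / 2.
have r1 : r < rho' by rewrite /rho'; lra.
have r2 : rho' < rho by rewrite /rho'; lra.
have gc w : cmod (w - z0) <= rho' -> ccont g w.
  by move=> h; apply/cdiff_cont/gd; lra.
have [m hm] := cdisk_bounded gc.
have [w wr|mu mu0 hmu] := cdisk_away0 gc; first by apply: g0; lra.
pose B := 2 * m / (rho' - r).
have lipg w1 w2 : cmod (w1 - z0) <= r -> cmod (w2 - z0) <= r ->
    cmod (g w1 - g w2) <= B * cmod (w1 - w2).
  apply: lipschitz_disk => // w wr; [by apply: gd; lra|by apply: hm; exact: ltW].
have B0 : 0 <= B.
  have : 0 <= m by apply: le_trans (hm z0 _); rewrite ?cmod_ge0 ?subrr ?cmod0//; lra.
  by move=> m0; rewrite /B divr_ge0// ?mulr_ge0// subr_ge0 ltW.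
pose c := B * r / mu.
have c0 : 0 <= c by exact: divr_ge0 (mulr_ge0 B0 (ltW r0)) (ltW mu0).
have e1 : 0 <= 12 * c ^+ 2 / eps.
  exact: divr_ge0 (mulr_ge0 (ler0n _ _) (sqr_ge0 _)) (ltW eps0).
(* The term 2c brings each ratio within 1/2 of 1, as [ln_cmod1D] requires; the other term makes N
   quadratic errors of size 12 (c / N)^2 add up to at most eps. *)
have [N hN] : exists N : nat, 2 * c + 12 * c ^+ 2 / eps < N%:R.
  exists (Num.bound (2 * c + 12 * c ^+ 2 / eps)); apply: archi_boundP.
  lra.
have N0 : 0 < N%:R :> R by apply: le_lt_trans hN; lra.
have cN1 : c / N%:R <= 1 / 2 by rewrite ler_pdivrMr//; lra.
have cN2 : N%:R * (12 * (c / N%:R) ^+ 2) <= eps.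
  have -> : N%:R * (12 * (c / N%:R) ^+ 2) = 12 * c ^+ 2 / N%:R.
    by field; rewrite gt_eqF.
  rewrite ler_pdivrMr// [eps * _]mulrC -ler_pdivrMr//; lra.
pose p (k : nat) w : C := z0 + ((k%:R / N%:R)%:C : C) * (w - z0).
have pd k w : cdiff (p k) w.
  apply: (cdiffD (cdiff_cst _ _)); apply: (cdiffM (cdiff_cst _ _)).
  exact: (cdiffB (cdiff_id _) (cdiff_cst _ _)).
have pr k w : (k <= N)%N -> cmod (p k w - z0) <= cmod (w - z0).
  move=> kN; rewrite /p [z0 + _]addrC addrK cmodM cmod_real ger0_norm ?divr_ge0//.
  by rewrite ler_piMl ?cmod_ge0// ler_pdivrMr// mul1r ler_nat.
pose q k w := g (p k.+1 w) * (g (p k w))^-1.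
exists (fun w => \sum_(k < N) (q k w - 1)).
have pin k w : (k <= N)%N -> cmod (w - z0) < r -> cmod (p k w - z0) < rho.
  by move=> kN wr; have := pr _ w kN; lra.
split=> [w wr||w wr].
- apply: cdiff_sum => k; apply: cdiffB; last exact: cdiff_cst.
  apply: cdiffM.
    apply: (@cdiff_comp _ g (p k.+1)); first exact: pd.
    by apply: gd; apply: pin.
  apply: cdiffV; first by apply: g0; apply: pin => //; exact: ltnW.
  apply: (@cdiff_comp _ g (p k)); first exact: pd.
  by apply: gd; apply: pin => //; exact: ltnW.
- apply: big1 => k _; rewrite /q /p subrr !mulr0 addr0 mulfV ?subrr//.
  by apply: g0; rewrite subrr cmod0; lra.
have gp k : (k <= N)%N -> 0 < cmod (g (p k w)).
  by move=> kN; rewrite cmod_gt0; apply: g0; exact: pin.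
have tel : ln (cmod (g w)) - ln (cmod (g z0)) = \sum_(k < N) ln (cmod (q k w)).
  have pN : p N w = w.
    by rewrite /p divff ?gt_eqF// mul1r addrC subrK.
  have p0 : p 0%N w = z0 by rewrite /p mul0r mul0r addr0.
  rewrite -{1}pN -{1}p0 -(big_mkord predT (fun k => ln (cmod (q k w)))).
  rewrite -(telescope_sumr (fun k => ln (cmod (g (p k w)))))//.
  apply: eq_big_nat => k /andP[_ kN]; rewrite /q cmodM cmodV ln_div ?posrE//.
    exact: gp.
  by apply: gp; exact: ltnW.
have ReL : complex.Re (\sum_(k < N) (q k w - 1)) =
    \sum_(k < N) complex.Re (q k w - 1).
  by apply: (big_morph (fun z : C => complex.Re z)) => // x y; exact: cReD.
rewrite tel ReL -sumrB.
apply: (le_trans (ler_norm_sum _ _ _)); apply: le_trans cN2.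
have -> : N%:R * (12 * (c / N%:R) ^+ 2) = \sum_(k < N) (12 * (c / N%:R) ^+ 2).
  by rewrite sumr_const card_ord mulr_natl.
apply: ler_sum => k _.
have qk : cmod (q k w - 1) <= c / N%:R.
  have gk := gp k (ltnW (ltn_ord k)).
  have gk0 : g (p k w) != 0 by rewrite -cmod_gt0.
  have -> : q k w - 1 = (g (p k.+1 w) - g (p k w)) * (g (p k w))^-1.
    by rewrite mulrBl mulfV.
  rewrite cmodM cmodV ler_pdivrMr//.
  have wr' : cmod (w - z0) <= r := ltW wr.
  apply: (le_trans (lipg _ _ _ _)).
  - exact: (le_trans (pr _ _ (ltn_ord k))).
  - exact: (le_trans (pr _ _ (ltnW (ltn_ord k)))).
  have -> : p k.+1 w - p k w = ((N%:R)^-1)%:C * (w - z0).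
    rewrite /p opprD addrACA subrr add0r -mulrBl; congr (_ * _).
    by rewrite -rmorphB /= -mulrBl -natrB// subSnn mul1r.
  rewrite cmodM cmod_real ger0_norm ?invr_ge0//.
  have h1 : mu <= cmod (g (p k w)).
    by apply: hmu; have := pr _ w (ltnW (ltn_ord k)); lra.
  have -> : c / N%:R = (B * r / N%:R) / mu by rewrite /c; field; rewrite !gt_eqF.
  apply: (@le_trans _ _ (B * r / N%:R)).
    have : B * (N%:R^-1 * cmod (w - z0)) <= B * (N%:R^-1 * r).
      by rewrite ler_wpM2l// ler_wpM2l ?invr_ge0.
    lra.
  have X0 : 0 <= B * r / N%:R by exact: divr_ge0 (mulr_ge0 B0 (ltW r0)) (ltW N0).
  move: (B * r / N%:R) X0 => X X0.
  by rewrite mulrAC ler_pdivlMr// ler_wpM2l.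
have := @ln_cmod1D (q k w - 1) (le_trans qk cN1).
rewrite [1 + (_ - _)]addrC subrK => h; apply: (le_trans h); rewrite ler_wpM2l//.
by rewrite lerXn2r ?nnegrE ?cmod_ge0// divr_ge0.
Qed.

Lemma cont_ln_cmod g z r t : 0 <= r -> (forall w, cmod (w - z) = r -> ccont g w) ->
  (forall w, cmod (w - z) = r -> g w != 0) ->
  {for t, continuous (fun t => ln (cmod (g (circ z r t))))}.
Proof.
move=> r0 gc g0; apply: (@continuous_comp _ _ _ (fun t => cmod (g (circ z r t))) (@ln R)).
  apply: cont_cmod; apply: cont_path; first exact: circ_cont.
  by apply: gc; rewrite cmod_circ.
by apply: continuous_ln; rewrite cmod_gt0; apply: g0; rewrite cmod_circ.
Qed.

Lemma mean_value_ln g z0 r rho : 0 < r < rho ->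
  (forall w, cmod (w - z0) < rho -> cdiff g w) ->
  (forall w, cmod (w - z0) < rho -> g w != 0) ->
  cmean (fun w => ln (cmod (g w))) z0 r = ln (cmod (g z0)).
Proof.
move=> /andP[r0 rrho] gd g0.
apply/eqP; rewrite -subr_eq0 -normr_eq0; apply/eqP/le_anti; rewrite normr_ge0 andbT.
apply/ler_addgt0Pr => eps eps0; rewrite add0r.
pose r' := (r + rho) / 2.
have r1 : r < r' by rewrite /r'; lra.
have r2 : 0 < r' < rho by rewrite /r'; apply/andP; split; lra.
have [L [Ld L0 hL]] := log_approx r2 eps0 gd g0.
have gi : cint (fun w => ln (cmod (g w))) z0 r.
  apply: cint_cont => t; apply: cont_ln_cmod; first exact: ltW.
    by move=> w wr; apply/cdiff_cont/gd; rewrite wr.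
  by move=> w wr; apply/g0; rewrite wr.
have Li : cint (fun w => complex.Re (L w)) z0 r.
  apply: cint_Re; first exact: ltW.
  by move=> w wr; apply/cdiff_cont/Ld; rewrite wr.
have Lm : cmean (fun w => complex.Re (L w)) z0 r = 0.
  rewrite (@mean_value _ L z0 r r') ?L0 ?r0//.
    by apply/cdiff_cont/Ld; rewrite subrr cmod0; lra.
  by move=> w /andP[_]; exact: Ld.
have Li' := cintZ (-1) Li.
have := @cmeanD _ _ _ _ _ gi Li'.
rewrite cmeanZ// Lm mulr0 addr0 => <-.
apply: cmean_near; first exact: ltW.
  exact: cintD.
move=> w wr; have := hL w; rewrite wr => /(_ r1).
by rewrite mulN1r [_ - _ - ln _]addrAC.
Qed.

(** For an approximate logarithm L of g / g(z0), the map L / (L + 2 h0) sends the half-plane Re L >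
    -h0 into the unit disc and vanishes at z0, so Schwarz's lemma bounds it by d / r. The real part
    of L then gives the claim as eps tends to 0 and r to rho. *)
Lemma harnack g z0 rho b : 0 < rho ->
  (forall w, cmod (w - z0) < rho -> cdiff g w) ->
  (forall w, cmod (w - z0) < rho -> expR b <= cmod (g w)) ->
  forall w, cmod (w - z0) < rho ->
  (rho - cmod (w - z0)) * (ln (cmod (g z0)) - b) <=
  (rho + cmod (w - z0)) * (ln (cmod (g w)) - b).
Proof.
move=> rho0 gd gb w1 w1rho; set d := cmod (w1 - z0).
have d0 : 0 <= d := cmod_ge0 _.
have g0 w : cmod (w - z0) < rho -> g w != 0.
  by move=> /gb h; rewrite -cmod_gt0; apply: lt_le_trans h; exact: expR_gt0.
have lnb w : cmod (w - z0) < rho -> b <= ln (cmod (g w)).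
  move=> h; rewrite -[b]expRK ler_ln ?posrE ?expR_gt0 ?gb//.
  by rewrite cmod_gt0 g0.
pose a := ln (cmod (g z0)) - b; pose U := ln (cmod (g w1)) - b.
rewrite -/a -/U.
have a0 : 0 <= a by rewrite subr_ge0; apply: lnb; rewrite subrr cmod0.
suff : 0 <= (U - a) * rho + (U + a) * d by lra.
apply: (affine_limit w1rho) => r /andP[dr rrho].
have r0 : 0 < r by apply: le_lt_trans dr.
have dr' : d < r by [].
suff : (r - d) * a <= (r + d) * U by lra.
apply/ler_addgt0Pr => e' e'0; have rd : 0 < r + d by lra.
(* The losses add up to (r + 5d) eps, which is at most 3 (r + d) eps because d < r. *)
have [eps eps0 <-] : exists2 eps, 0 < eps & 3 * eps * (r + d) = e'.
  exists (e' / (3 * (r + d))); first by rewrite divr_gt0// mulr_gt0.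
  by field; rewrite gt_eqF.
have rr : 0 < r < rho by rewrite r0.
have [L [Ld L0 hL]] := log_approx rr eps0 gd g0.
(* The approximation gives Re L >= -a - eps on the disc; a second eps makes the inequality Re L >
   -h0 strict and h0 positive. *)
pose h0 := a + 2 * eps.
have h00 : 0 < h0 by rewrite /h0; lra.
have ReL w : cmod (w - z0) < r -> - h0 < complex.Re (L w).
  move=> wr; have := hL _ wr; have := lnb w (lt_trans wr rrho).
  rewrite ler_norml /h0 /a => k1 /andP[k2 k3]; lra.
pose h w : C := L w + (2 * h0)%:C.
have Reh w : cmod (w - z0) < r -> 0 < complex.Re (h w).
  by move=> /ReL; rewrite /h cReD /=; lra.
have hne w : cmod (w - z0) < r -> h w != 0.
  by move=> /Reh; apply: contraTneq => ->; rewrite ltxx.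
pose q w := L w * (h w)^-1.
have qd w : cmod (w - z0) < r -> cdiff q w.
  move=> wr; apply: (cdiffM (Ld _ wr)); apply: cdiffV; first exact: hne.
  exact: (cdiffD (Ld _ wr) (cdiff_cst _ _)).
have q1 w : cmod (w - z0) < r -> cmod (q w - q z0) <= 1.
  move=> wr; rewrite /q L0 mul0r subr0 cmodM cmodV ler_pdivrMr ?cmod_gt0 ?hne//.
  rewrite mul1r -(@ler_pXn2r _ 2) ?nnegrE ?cmod_ge0// !cmod_Re_sqr /h cReD cImD /=.
  rewrite addr0 lerD2r; have := ReL _ wr; nra.
have := schwarz r0 qd q1 dr; rewrite mul1r -/d {2}/q L0 mul0r subr0.
rewrite /q cmodM cmodV mulrAC ler_pdivrMr ?cmod_gt0 ?hne//.
rewrite -(@ler_pXn2r _ 2) ?nnegrE ?mulr_ge0 ?cmod_ge0 ?(ltW r0)//.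
rewrite !exprMn (cmod_Re_sqr (L w1)) (cmod_Re_sqr (h w1)) /h cReD cImD /= addr0.
have := ReL _ dr; have := hL _ dr; rewrite ler_norml => /andP[_].
set x := complex.Re (L w1); set y := complex.Im (L w1) => k1 k2 k3.
have k4 : U - x <= a + eps by rewrite /U /a; lra.
have k4' : x + a - eps <= U.
  have := hL _ dr; rewrite ler_norml -/x /U /a => /andP[]; lra.
have k5 : x ^+ 2 * r ^+ 2 <= d ^+ 2 * (x + 2 * h0) ^+ 2.
  have : 0 <= y ^+ 2 * ((r - d) * (r + d)).
    by rewrite mulr_ge0 ?sqr_ge0// mulr_ge0//; lra.
  lra.
have k6 : - x * r <= d * (x + 2 * h0).
  have [xr|xr] := leP (- x * r) 0; first by rewrite (le_trans xr)// mulr_ge0//; lra.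
  rewrite -(@ler_pXn2r _ 2) ?nnegrE ?(ltW xr)//; last by rewrite mulr_ge0//; lra.
  by rewrite !exprMn sqrrN.
have : (r + d) * (x + a - eps) <= (r + d) * U by rewrite ler_pM2l.
rewrite /h0 in k6; have := mulr_ge0 d0 (ltW eps0).
have := mulr_ge0 (ltW r0) (ltW eps0); nra.
Qed.

End LogHarmonic.

(** * The maximum modulus function *)

Section MaximumModulus.
Variable R : realType.
Local Notation C := (CC R).
Implicit Types (z w : C) (r s : R).

Lemma set_max_eq (S : set R) m : S m -> ubound S m -> set_max S = m.
Proof.
move=> Sm ubm; rewrite /set_max; case: xgetP => [x _ [Sx ubx]|/(_ m)[]//].
by apply/le_anti; rewrite (ubm _ Sx) (ubx _ Sm).
Qed.

Lemma annulus_compact r s : compact [set w : C | r <= cmod w <= s].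
Proof.
have cm : continuous (fun w : C => cmod w).
  move=> w; exact: (@cont_cmodR _ (fun w => w) w (ccont_id w)).
apply: (subclosed_compact _ (@cdisk_compact R 0 s)).
  have -> : [set w : C | r <= cmod w <= s] =
     (fun w => cmod w) @^-1` [set x | r <= x] `&`
     (fun w => cmod w) @^-1` [set x | x <= s].
    by apply/seteqP; split => w /= => [/andP[]//|[-> ->]].
  by apply: closedI; apply: closed_comp => [w _|]; [exact: cm|exact: closed_ge|
    exact: cm|exact: closed_le].
by move=> w /= /andP[_]; rewrite subr0.
Qed.

Variable f : C -> C.
Variable fd : forall w, cdiff f w.
Variable f0 : f 0 = 0.
Variable ft : ~ exists p : {poly R[i]}, forall z, f z = p.[z].
Local Notation M := (maxmod f).

Lemma maxmodP r : 0 <= r -> (exists2 z, cmod z = r & cmod (f z) = M r) /\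
  forall z, cmod z = r -> cmod (f z) <= M r.
Proof.
move=> r0.
have [|c /set_mem /= cr cmax] := @compact_EVT_max C R (fun w => cmod (f w))
    _ _ (@annulus_compact r r)
    (@continuous_in_subspaceT _ _ _ _ (fun w _ => cont_cmodR (cdiff_cont (fd w)))).
  have cr : cmod (r%:C : C) = r by rewrite cmod_real ger0_norm.
  by exists (r%:C : C); apply/andP; rewrite cr lexx.
have cr' : cmod c = r by apply/le_anti; rewrite andbC.
have -> : M r = cmod (f c).
  apply: set_max_eq; first by exists c.
  by move=> _ [z /= zr <-]; apply: cmax; rewrite inE /= zr lexx.
split; first by exists c.
by move=> z zr; apply: cmax; rewrite inE /= zr lexx.
Qed.

Lemma le_maxmod z : cmod (f z) <= M (cmod z).
Proof. by apply: (maxmodP (cmod_ge0 z)).2. Qed.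

Lemma maxmod_ge0 r : 0 <= r -> 0 <= M r.
Proof. by move=> /maxmodP[[z _ <-] _]; exact: cmod_ge0. Qed.

Lemma maxmod0 : M 0 = 0.
Proof.
have [[z z0 <-] _] := maxmodP (lexx 0).
by have /eqP := z0; rewrite cmod_eq0 => /eqP ->; rewrite f0 cmod0.
Qed.

(** The circle is empty and [set_max] returns its default; this value matters for two-sided
    continuity at 0. *)
Lemma maxmod_neg r : r < 0 -> M r = 0.
Proof.
move=> r0; rewrite /maxmod /set_max; case: xgetP => // x _ [[z /= zr _] _].
by move: r0; rewrite -zr ltNge cmod_ge0.
Qed.

Lemma cmod_le_maxmod z r : cmod z <= r -> cmod (f z) <= M r.
Proof.
move=> zr; have r0 : 0 <= r := le_trans (cmod_ge0 z) zr.
apply: (@max_disk _ [::] f 0 r); rewrite ?subr0//.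
- by move=> w _; exact: cdiff_cont.
- by move=> w; rewrite subr0; exact: (maxmodP r0).2.
Qed.

Lemma maxmod_le r s : 0 <= r -> r <= s -> M r <= M s.
Proof.
move=> r0 rs; have [[z zr <-] _] := maxmodP r0.
by apply: cmod_le_maxmod; rewrite zr.
Qed.

(** Since f(0) = 0, Schwarz's lemma makes M(r) / r nondecreasing. Together with positivity this
    gives the strict monotonicity of M. *)
Lemma maxmod_ratio r s : 0 <= r -> r < s -> M r * s <= M s * r.
Proof.
move=> r0 rs; have s0 : 0 < s := le_lt_trans r0 rs.
have [[z zr <-] _] := maxmodP r0.
have := @schwarz _ f 0 s (M s) s0 (fun w _ => fd w) _ z.
rewrite f0 !subr0 zr; apply => // w; rewrite !subr0 => /ltW; exact: cmod_le_maxmod.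
Qed.

(** The maximum principle on the annulus for f^q / z^p. Integer exponents stand in for the power
    z^(p/q), which would not be single-valued. *)
Lemma three_circles (p q : nat) r1 r2 r m : 0 < r1 -> r1 <= r <= r2 ->
  M r1 ^+ q <= m * r1 ^+ p -> M r2 ^+ q <= m * r2 ^+ p ->
  M r ^+ q <= m * r ^+ p.
Proof.
move=> r10 /andP[r1r rr2] h1 h2; have r0 : 0 < r := lt_le_trans r10 r1r.
have [[z zr <-] _] := maxmodP (ltW r0).
pose F w := f w ^+ q * (w ^+ p)^-1.
have Fd w : 0 < cmod w -> cdiff F w.
  rewrite cmod_gt0 => w0; apply: cdiffM; first exact: cdiffX.
  by apply: cdiffV; [rewrite expf_neq0|apply: cdiffX; exact: cdiff_id].
have := @maximum_principle _ [set w | r1 <= cmod w <= r2]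
  [set w | cmod w = r1 \/ cmod w = r2] F m (@annulus_compact r1 r2).
have Fz w : 0 < cmod w -> (cmod (F w) <= m) = (cmod (f w) ^+ q <= m * cmod w ^+ p).
  by move=> w0; rewrite /F cmodM cmodV !cmodX ler_pdivrMr// exprn_gt0.
move=> /(_ _ _ _ z) H; rewrite -zr -Fz ?zr//; apply: H.
- by move=> w /= /andP[w1 _]; apply/cdiff_cont/Fd; exact: lt_le_trans w1.
- move=> w /= /andP[w1 w2].
  have [wr1|wr1] := eqVneq (cmod w) r1; first by left; left.
  have [wr2|wr2] := eqVneq (cmod w) r2; first by left; right.
  right; exists (Num.min (cmod w - r1) (r2 - cmod w)).
    by rewrite lt_min !subr_gt0 !lt_neqAle w1 w2 wr2 eq_sym wr1.
  move=> w'; rewrite lt_min => /and3P[_ w'1 w'2].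
  have := cmod_ler_dist w' w; rewrite ler_norml => /andP[k1 k2].
  by split; [apply/andP; split; lra|apply: Fd; lra].
- move=> w /= /andP[w1 w2] wb; have w0 : 0 < cmod w := lt_le_trans r10 w1.
  rewrite Fz//; case: wb => wr; rewrite wr.
    apply: le_trans h1; rewrite lerXn2r ?nnegrE ?cmod_ge0 ?maxmod_ge0 ?(ltW r10)//.
    by rewrite -wr le_maxmod.
  have r20 : 0 <= r2 by rewrite -wr cmod_ge0.
  apply: le_trans h2; rewrite lerXn2r ?nnegrE ?cmod_ge0 ?maxmod_ge0//.
  by rewrite -wr le_maxmod.
- by rewrite /= zr r1r.
Qed.

(** This is where transcendence enters: otherwise M(r) <= r^n on arbitrarily large circles, and f
    would be a polynomial. *)
Lemma maxmod_superpoly (n : nat) : exists r0, forall r, r0 < r -> r ^+ n < M r.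
Proof.
apply: contrapT => h; apply: ft.
apply: (@liouville_poly _ n [::] f 1) => //; first by move=> w; exact: cdiff_cont.
move=> r0; apply: contrapT => h'; apply: h; exists (Num.max r0 0) => r.
rewrite gt_max => /andP[r0r rpos]; rewrite ltNge; apply/negP => Mr; apply: h'.
exists r => // w wr; rewrite mul1r; apply: le_trans Mr.
by apply: cmod_le_maxmod; rewrite wr.
Qed.

(** A substitute for the identity theorem: if M(r) = 0, three circles with q = 1 and p = n give M(s)
    <= M(2s) / 2^n for every n, whereas M(s) > 1 for large s. *)
Lemma maxmod_gt0 r : 0 < r -> 0 < M r.
Proof.
move=> r0; rewrite lt_neqAle maxmod_ge0 ?(ltW r0)// andbT eq_sym; apply/eqP => Mr0.
have [r1 hr1] := maxmod_superpoly 0.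
pose s := Num.max r r1 + 1.
have rs : r < s by rewrite /s -[ltLHS]addr0 ler_ltD// le_max lexx.
have s1 : r1 < s by rewrite /s -[ltLHS]addr0 ler_ltD// le_max lexx orbT.
have := hr1 _ s1; rewrite expr0.
have s0 : 0 < s by rewrite (lt_trans r0).
have [n hn] := @half_pow_small _ (M (2 * s)) 1 ltr01.
have := @three_circles n 1 r (2 * s) s (M (2 * s) / (2 * s) ^+ n) r0.
rewrite !expr1 Mr0 => H.
suff : M s <= M (2 * s) / (2 * s) ^+ n * s ^+ n.
  have -> : M (2 * s) / (2 * s) ^+ n * s ^+ n = M (2 * s) / 2 ^+ n.
    by rewrite exprMn; field; rewrite !expf_neq0 ?gt_eqF.
  lra.
apply: H.
- by apply/andP; split; lra.
- by rewrite mulr_ge0 ?exprn_ge0 ?divr_ge0 ?maxmod_ge0 ?exprn_ge0//; lra.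
- by rewrite divfK// expf_neq0// gt_eqF//; lra.
Qed.

Lemma maxmod_lt r s : 0 <= r -> r < s -> M r < M s.
Proof.
move=> r0 rs; have s0 : 0 < s := le_lt_trans r0 rs.
rewrite -(ltr_pM2r s0); apply: le_lt_trans (maxmod_ratio r0 rs) _.
by rewrite ltr_pM2l// maxmod_gt0.
Qed.

(** A maximum point on the circle of radius s is compared with its radial projection to the circle
    of radius t, using a Lipschitz constant of f on a larger disc. Negative radii reduce to the
    comparison with M(0) = 0. *)
Lemma maxmod_cont r : 0 <= r -> {for r, continuous M}.
Proof.
move=> r0.
have [B [B0 hB]] : exists B, 0 <= B /\ forall s t, 0 <= s <= r + 1 -> 0 <= t <= r + 1 ->
    M s <= M t + B * `|s - t|.
  have r12 : r + 1 < r + 2 by lra.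
  have bd w : cmod (w - 0) < r + 2 -> cmod (f w) <= M (r + 2).
    by rewrite subr0 => /ltW; exact: cmod_le_maxmod.
  have lip := @lipschitz_disk _ f 0 (r + 1) (r + 2) (M (r + 2)) r12 (fun w _ => fd w) bd.
  have B0 : 0 <= 2 * M (r + 2) / (r + 2 - (r + 1)).
    by rewrite divr_ge0 ?mulr_ge0 ?maxmod_ge0//; lra.
  exists (2 * M (r + 2) / (r + 2 - (r + 1))); split => // s t.
  move: (2 * M (r + 2) / (r + 2 - (r + 1))) lip B0 => B lip B0.
  move=> /andP[s0 sr] /andP[t0 tr].
  have [s00|s0'] := eqVneq s 0.
    by rewrite s00 maxmod0 addr_ge0 ?maxmod_ge0// mulr_ge0.
  have [[z zs <-] _] := maxmodP s0.
  have z0 : z != 0 by rewrite -cmod_eq0 zs.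
  pose w : C := (t / s)%:C * z.
  have wt : cmod w = t.
    by rewrite /w cmodM cmod_real zs ger0_norm ?divr_ge0// divfK.
  have -> : `|s - t| = cmod (z - w).
    have -> : z - w = ((s - t) / s)%:C * z.
      by rewrite /w mulrBl divff// rmorphB /= mulrBl mul1r.
    rewrite cmodM cmod_real zs normrM normrV ?unitfE// (ger0_norm s0).
    by rewrite divfK.
  have := lip z w; rewrite !subr0 zs wt => /(_ sr tr) h.
  have := le_maxmod w; rewrite wt.
  have := cmod_ler_sub (f z) (f w); lra.
have hB' s : s <= r + 1 -> `|M s - M r| <= B * `|s - r|.
  move=> sr1; have rr : 0 <= r <= r + 1 by rewrite r0 /=; lra.
  have [s0|s0] := leP 0 s.
    have ss : 0 <= s <= r + 1 by rewrite s0.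
    have := hB _ _ ss rr; have := hB _ _ rr ss.
    rewrite [`|r - s|]distrC ler_norml => k1 k2.
    by apply/andP; split; lra.
  have z0 : 0 <= (0 : R) <= r + 1 by rewrite lexx /=; lra.
  rewrite maxmod_neg// sub0r normrN ger0_norm ?maxmod_ge0//.
  have := hB _ _ rr z0; rewrite maxmod0 add0r subr0 ger0_norm// => k.
  apply: (le_trans k); rewrite ler_wpM2l// ler0_norm; lra.
apply/contP => e e0; exists (Num.min 1 (e / (B + 1))).
  by rewrite lt_min ltr01 divr_gt0//; lra.
move=> s; rewrite lt_min => /andP[s1 s2].
have B1 : 0 < B + 1 by lra.
have : s <= r + 1 by move: s1; rewrite ltr_norml => /andP[]; lra.
move=> /hB' h; apply: le_lt_trans h _.
rewrite ltr_pdivlMr// in s2; have := normr_ge0 (s - r); lra.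
Qed.

Lemma maxmod_onto y : 0 <= y -> exists2 r, 0 <= r & M r = y.
Proof.
move=> y0; have [r0 h] := maxmod_superpoly 1.
pose r := Num.max r0 (Num.max y 0) + 1.
have h1 : r0 < r by rewrite /r -[ltLHS]addr0 ler_ltD// le_max lexx.
have h2 : y < r by rewrite /r -[ltLHS]addr0 ler_ltD// !le_max lexx orbT.
have h3 : 0 <= r by lra.
have := h _ h1; rewrite expr1 => rM.
have Mr : 0 <= M r by exact: maxmod_ge0.
have [||c] := @IVT R M 0 r y h3.
- apply/continuous_in_subspaceT => x /set_mem /=; rewrite in_itv/= => /andP[x0 _].
  exact: maxmod_cont.
- by rewrite maxmod0 min_l// max_r// y0/=; lra.
- by rewrite in_itv/= => /andP[c0 _] <-; exists c.
Qed.

(** * Convexity of log M in the logarithmic variable *)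

Definition logmax (t : R) : R := ln (M (expR t)).
Local Notation phi := logmax.

Lemma logmaxK t : expR (phi t) = M (expR t).
Proof. by rewrite lnK// posrE maxmod_gt0// expR_gt0. Qed.

Lemma logmax_lt s t : s < t -> phi s < phi t.
Proof.
move=> st; rewrite -ltr_expR !logmaxK; apply: maxmod_lt; first exact: expR_ge0.
by rewrite ltr_expR.
Qed.

Lemma logmax_le s t : s <= t -> phi s <= phi t.
Proof. by rewrite le_eqVlt => /predU1P[->//|/logmax_lt/ltW]. Qed.

Lemma three_circles_log (p q : nat) a t b m : a <= t <= b ->
  phi a *+ q <= m + a *+ p -> phi b *+ q <= m + b *+ p ->
  phi t *+ q <= m + t *+ p.
Proof.
move=> /andP[h1 h2].
have E x : (phi x *+ q <= m + x *+ p) = (M (expR x) ^+ q <= expR m * expR x ^+ p).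
  by rewrite -logmaxK -!expRM_natl -expRD ler_expR !mulr_natl.
rewrite !E; apply: three_circles; first exact: expR_gt0.
by rewrite !ler_expR h1.
Qed.

Definition convexR (u : R -> R) := forall a b l, 0 <= l <= 1 ->
  u ((1 - l) * a + l * b) <= (1 - l) * u a + l * u b.

Lemma convexR_lt (u : R -> R) : (forall a b l, a < b -> 0 < l < 1 ->
  u ((1 - l) * a + l * b) <= (1 - l) * u a + l * u b) -> convexR u.
Proof.
move=> h a b l /andP[l0 l1].
have [->|l0'] := eqVneq l 0; first by rewrite !subr0 !mul1r !mul0r !addr0.
have [->|l1'] := eqVneq l 1; first by rewrite !subrr !mul1r !mul0r !add0r.
have l01 : 0 < l < 1 by rewrite !lt_neqAle l0 l1 l1' eq_sym l0'.
have [ab|ba|->] := ltgtP a b; first exact: h.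
- have -> : (1 - l) * a + l * b = (1 - (1 - l)) * b + (1 - l) * a by ring.
  have -> : (1 - l) * u a + l * u b = (1 - (1 - l)) * u b + (1 - l) * u a by ring.
  by apply: h => //; move/andP: l01 => [k1 k2]; apply/andP; split; lra.
- by rewrite -!mulrDl subrK !mul1r.
Qed.

Lemma logmax_convex : convexR phi.
Proof.
apply: convexR_lt => a b l ab /andP[l0 l1]; set t := (1 - l) * a + l * b.
rewrite leNgt; apply/negP => bad.
pose al := (phi b - phi a) / (b - a).
have ba0 : 0 < b - a by lra.
have al0 : 0 <= al.
  by rewrite divr_ge0 ?subr_ge0 ?(ltW ab)// logmax_le// ltW.
have alE : al * (b - a) = phi b - phi a by rewrite /al divfK// gt_eqF.
have tE : t - a = l * (b - a) by rewrite /t; ring.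
have tE' : b - t = (1 - l) * (b - a) by rewrite /t; ring.
have ta : a < t by rewrite -subr_gt0 tE mulr_gt0.
have tb : t < b by rewrite -subr_gt0 tE' mulr_gt0// subr_gt0.
pose del := phi t - ((1 - l) * phi a + l * phi b).
have del0 : 0 < del by rewrite /del subr_gt0.
have ha : phi t - phi a = del + al * (t - a).
  by rewrite tE mulrCA alE /del; ring.
have hb : phi b - phi t = al * (b - t) - del.
  by rewrite tE' mulrCA alE /del; ring.
(* The slope [al] of the chord is nonnegative but need not be rational. With p the integer part of
   al q, the slope error x = al q - p is at most 1 and costs at most b - a over the interval, less
   than the gain q del. *)
have [q hq] : exists q : nat, (b - a) / del < q%:R.
  by exists (Num.bound ((b - a) / del)); apply: archi_boundP; rewrite divr_ge0// ltW.
have q0 : 0 < q%:R :> R by apply: le_lt_trans hq; rewrite divr_ge0// ltW.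
rewrite ltr_pdivrMr// in hq.
pose p := Num.trunc (al * q%:R).
have /andP[p1 p2] : p%:R <= al * q%:R < p.+1%:R.
  by apply: trunc_itv; rewrite mulr_ge0// ltW.
rewrite -natr1 in p2.
pose x := al * q%:R - p%:R.
have x0 : 0 <= x by rewrite subr_ge0.
have x1 : x <= 1 by rewrite /x lerBlDl ltW.
pose m := Num.max (q%:R * phi a - p%:R * a) (q%:R * phi b - p%:R * b).
have := @three_circles_log p q a t b m.
have E (y : R) k : y *+ k = k%:R * y by rewrite mulr_natl.
rewrite (ltW ta) (ltW tb) (E (phi a)) (E (phi b)) (E (phi t)) (E a) (E b) (E t).
move=> /(_ isT).
have ma : q%:R * phi a - p%:R * a <= m by rewrite le_max lexx.
have mb : q%:R * phi b - p%:R * b <= m by rewrite le_max lexx orbT.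
move=> H; have : q%:R * phi t <= m + p%:R * t.
  by apply: H; [clear - ma|clear - mb]; lra.
apply/negP; rewrite -ltNge.
have qa : q%:R * phi t - q%:R * phi a = q%:R * del + (x + p%:R) * (t - a).
  by rewrite -mulrBr ha /x; ring.
have qb : q%:R * phi b - q%:R * phi t = (x + p%:R) * (b - t) - q%:R * del.
  by rewrite -mulrBr hb /x; ring.
have xa : 0 <= x * (t - a) by rewrite mulr_ge0// subr_ge0 ltW.
have xb : x * (b - t) <= b - t by rewrite ler_piMl// subr_ge0 ltW.
have qdel : 0 < q%:R * del by rewrite mulr_gt0.
rewrite -ltrBrDr /m gt_max; apply/andP; split.
  by clear - qa xa qdel; lra.
by clear - qb xb hq ta; lra.
Qed.

End MaximumModulus.

(** * Iterates of M, the threshold [R_f] and the levels of the fast escaping set *)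

Section FastEscaping.
Variable R : realType.
Local Notation C := (CC R).
Implicit Types (z w : C) (r s t : R).
Variable f : C -> C.
Variable fd : forall w, cdiff f w.
Variable f0 : f 0 = 0.
Variable ft : ~ exists p : {poly R[i]}, forall z, f z = p.[z].
Local Notation M := (maxmod f).
Local Notation phi := (logmax f).

Lemma iter_maxmod_ge0 n r : 0 <= r -> 0 <= iter n M r.
Proof. by move=> r0; elim: n => [//|n IH]; exact: (maxmod_ge0 fd). Qed.

Lemma iter_maxmod0 n : iter n M 0 = 0.
Proof. by elim: n => [//|n IH] /=; rewrite IH (maxmod0 fd f0). Qed.

Lemma iter_maxmod_lt n r s : 0 <= r -> r < s -> iter n M r < iter n M s.
Proof.
move=> r0 rs; elim: n => [//|n IH]; apply: (maxmod_lt fd f0 ft) => //.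
exact: iter_maxmod_ge0.
Qed.

Lemma iter_maxmod_le n r s : 0 <= r -> r <= s -> iter n M r <= iter n M s.
Proof.
move=> r0; rewrite le_eqVlt => /predU1P[->//|rs].
exact/ltW/iter_maxmod_lt.
Qed.

Lemma iter_maxmod_cont n r : 0 <= r -> {for r, continuous (iter n M)}.
Proof.
move=> r0; elim: n => [|n IH]; first by move=> V.
apply: (continuous_comp IH); apply: (maxmod_cont fd f0); exact: iter_maxmod_ge0.
Qed.

Lemma iter_maxmod_onto n y : 0 <= y -> exists2 r, 0 <= r & iter n M r = y.
Proof.
elim: n y => [|n IH] y y0; first by exists y.
have [r r0 rE] := maxmod_onto fd f0 ft y0; have [s s0 sE] := IH _ r0.
by exists s => //=; rewrite sE.
Qed.

Lemma cmod_iter_le n k z :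
  cmod (iter (n + k) f z) <= iter n M (cmod (iter k f z)).
Proof.
elim: n => [|n IH]; first by rewrite add0n.
rewrite addSn !iterS; apply: (le_trans (le_maxmod fd _)).
by apply: (maxmod_le fd) => //; exact: cmod_ge0.
Qed.

Lemma iter_logmaxK n t : expR (iter n phi t) = iter n M (expR t).
Proof. by elim: n => [//|n IH]; rewrite /= (logmaxK fd ft) IH. Qed.

Lemma iter_logmax_convex n : convexR (iter n phi).
Proof.
elim: n => [a b l _|n IH a b l l01]; first by rewrite lexx.
apply: le_trans (logmax_convex fd f0 ft _ _ l01).
by apply: (logmax_le fd f0 ft); exact: IH.
Qed.

(** Superpolynomial growth gives phi(t) > K t with K > |phi(1)| + 2. Convexity at 1, t, 5t gives (t
    - 1) phi(5t) >= (5t - 1) phi(t) - 4t phi(1), and 4t phi(1) <= 4 phi(t). *)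
Lemma logmax_growth : exists2 T, 1 <= T & forall t, T <= t ->
  t + 1 <= phi t /\ 5 * phi t <= phi (5 * t).
Proof.
have [K hK] : exists K : nat, `|phi 1| + 2 < K%:R.
  by exists (Num.bound (`|phi 1| + 2)); apply: archi_boundP; rewrite addr_ge0.
have [r0 hr0] := maxmod_superpoly fd ft K.
have hphi := ler_norm (phi 1); have hphi0 := normr_ge0 (phi 1).
exists (Num.max 2 `|r0|); first by rewrite le_max ler1n.
move=> t; rewrite ge_max => /andP[t2 tr0].
have Kt : K%:R * t < phi t.
  rewrite -ltr_expR (logmaxK fd ft) expRM_natl; apply: hr0.
  by have := expR_ge1Dx t; have := ler_norm r0; lra.
have K2t : 2 * t <= K%:R * t by rewrite ler_wpM2r//; lra.
have phi1 : phi 1 * t <= phi t.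
  by apply: le_trans (ltW Kt); rewrite ler_wpM2r//; lra.
split; first lra.
have D0 : 0 < 5 * t - 1 by lra.
pose l := (t - 1) / (5 * t - 1).
have l01 : 0 <= l <= 1.
  by rewrite /l divr_ge0 ?ler_pdivrMr// ?subr_ge0; lra.
have := logmax_convex fd f0 ft 1 (5 * t) l01.
have -> : (1 - l) * 1 + l * (5 * t) = t by rewrite /l; field; rewrite gt_eqF.
have lD : l * (5 * t - 1) = t - 1 by rewrite /l divfK// gt_eqF.
move=> h; have := ler_wpM2r (ltW D0) h; move: (phi (5 * t)) => P.
have -> : ((1 - l) * phi 1 + l * P) * (5 * t - 1) =
    phi 1 * (5 * t - 1 - l * (5 * t - 1)) + P * (l * (5 * t - 1)) by ring.
rewrite lD => h'; have t1 : 0 < t - 1 by lra.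
rewrite -(ler_pM2r t1); lra.
Qed.

Lemma to_inftyP r : maxmod_to_infty f r <->
  forall A, exists N, forall n, (N <= n)%N -> A <= iter n M r.
Proof.
split=> [/cvgryPge h A|h].
  by have [N _ hN] := h A; exists N => n Nn; exact: hN.
by apply/cvgryPge => A; have [N hN] := h A; exists N => // n /=; exact: hN.
Qed.

Lemma to_infty_le r s : 0 <= r -> r <= s -> maxmod_to_infty f r ->
  maxmod_to_infty f s.
Proof.
move=> r0 rs /to_inftyP h; apply/to_inftyP => A; have [N hN] := h A.
by exists N => n /hN /le_trans; apply; exact: iter_maxmod_le.
Qed.

Lemma to_infty_shift k r : maxmod_to_infty f (iter k M r) <-> maxmod_to_infty f r.
Proof.
split=> /to_inftyP h; apply/to_inftyP => A; have [N hN] := h A.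
  exists (N + k)%N => n Nn; rewrite -(@subnK k n) ?iterD; last first.
    by apply: leq_trans Nn; rewrite leq_addl.
  by apply: hN; rewrite leq_subRL ?(addnC k)// (leq_trans _ Nn)// leq_addl.
by exists N => n Nn; rewrite -iterD; apply: hN; rewrite (leq_trans Nn)// leq_addr.
Qed.

Lemma to_infty_big : exists2 T, 1 <= T & (forall t, T <= t ->
    [/\ t + 1 <= phi t, 5 * phi t <= phi (5 * t) & maxmod_to_infty f (expR t)]).
Proof.
have [T T1 hT] := logmax_growth; exists T => // t tT.
have [h1 h2] := hT _ tT; split=> //.
have it n : T <= iter n phi t /\ t + n%:R <= iter n phi t.
  elim: n => [|n [IH1 IH2]]; first by rewrite addr0.
  have [k1 _] := hT _ IH1; rewrite iterS -natr1; split; lra.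
apply/to_inftyP => A; exists (Num.bound `|A|) => n An.
have AA := archi_boundP (normr_ge0 A).
rewrite -iter_logmaxK; have [_ h] := it n.
have := expR_ge1Dx (iter n phi t); have := ler_norm A.
have : (Num.bound `|A|)%:R <= n%:R :> R by rewrite ler_nat.
lra.
Qed.

Lemma to_infty_gt0 r : 0 <= r -> maxmod_to_infty f r -> 0 < r.
Proof.
move=> r0 /to_inftyP h; rewrite lt_neqAle r0 andbT; apply/eqP => r00.
have [N /(_ N (leqnn _))] := h 1; rewrite -r00 iter_maxmod0; lra.
Qed.

(** Some iterate of M at r exceeds e^T by 1, and by continuity of that iterate it still exceeds e^T
    slightly to the left of r. *)
Lemma to_infty_open r : 0 <= r -> maxmod_to_infty f r ->
  exists2 s, 0 <= s < r & maxmod_to_infty f s.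
Proof.
move=> r0 h; have rpos := to_infty_gt0 r0 h.
have [T T1 hT] := to_infty_big; have [_ _ eT] := hT _ (lexx T).
have [N /(_ N (leqnn _)) hN] := (to_inftyP r).1 h (expR T + 1).
have /contP/(_ 1 ltr01)[d d0 hd] := @iter_maxmod_cont N r r0.
pose s := Num.max 0 (r - d / 2).
have sr : s < r by rewrite gt_max rpos; lra.
have s0 : 0 <= s by rewrite le_max lexx.
have rs : r - d / 2 <= s by rewrite le_max lexx orbT.
exists s; first by rewrite s0.
apply/(to_infty_shift N); apply: to_infty_le eT; first exact: expR_ge0.
have := hd s; rewrite ltr_norml ltr_norml => /(_ _)/andP[]; last lra.
by apply/andP; split; lra.
Qed.

(** The radii that do not tend to infinity form an initial segment, closed by [to_infty_open]; so
    the maximum defining [R_f] is attained and no default value occurs. *)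
Lemma R_fP : [/\ 0 <= R_f f, ~ maxmod_to_infty f (R_f f) &
  forall r, R_f f < r -> maxmod_to_infty f r].
Proof.
pose E := [set r | 0 <= r /\ ~ maxmod_to_infty f r].
have [T T1 hT] := to_infty_big; have [_ _ eT] := hT _ (lexx T).
have E0 : E 0 by split=> //; move=> /(to_infty_gt0 (lexx 0)); rewrite ltxx.
have ubE s : 0 <= s -> maxmod_to_infty f s -> ubound E s.
  move=> s0 h r [r0 hr]; rewrite leNgt; apply/negP => /ltW sr; apply: hr.
  exact: to_infty_le h.
have sE : has_sup E by split; [exists 0|exists (expR T); apply: ubE; rewrite ?expR_ge0].
have s0 : 0 <= sup E by apply: (ub_le_sup sE.2).
have Es : E (sup E).
  split=> // h; have [s /andP[s0' ssup] hs] := to_infty_open s0 h.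
  have := ge_sup sE.1 (ubE _ s0' hs); lra.
have RfE : R_f f = sup E by apply: set_max_eq => // r Er; exact: (ub_le_sup sE.2).
rewrite RfE; split=> //; first exact: Es.2.
move=> r sr; apply: contrapT => h; suff : r <= sup E by lra.
by apply: (ub_le_sup sE.2); split=> //; lra.
Qed.

Lemma admissibleP r : admissible f r <-> R_f f < r.
Proof.
have [h1 h2 h3] := R_fP; split=> [[r0 h]|h]; last by split; [lra|exact: h3].
rewrite ltNge; apply/negP => rR; apply: h2; apply: to_infty_le h => //; exact: ltW.
Qed.

(** Only n < l needs an argument: if |f^n(z)| < M^n(s), applying M another l - n times gives
    |f^l(z)| < M^l(s) = r, against the hypothesis at 0. This trades the delay l for another
    level. *)
Lemma fast_level_shift l r s z : 0 <= s -> iter l M s = r ->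
  (forall n, iter n M r <= cmod (iter (n + l) f z)) -> fast_level f s z.
Proof.
move=> s0 <- h n; have [ln|nl] := leqP l n.
  by rewrite -(subnK ln) iterD; exact: h.
rewrite leNgt; apply/negP => bad.
have := iter_maxmod_lt (l - n) (cmod_ge0 _) bad.
rewrite -iterD subnK ?(ltnW nl)// ltNge; apply/negP; rewrite negbK.
apply: (le_trans (h 0%N)); rewrite add0n -{1}(subnK (ltnW nl)).
exact: cmod_iter_le.
Qed.

Lemma fast_escapingP z : fast_escaping f z <->
  exists2 r, admissible f r & fast_level f r z.
Proof.
split=> [[r [[r0 hr] [l hl]]]|[r ar lr]]; last first.
  by exists r; split=> //; exists 0%N => n; rewrite addn0.
have [s s0 sE] := iter_maxmod_onto l (ltW r0).
exists s; last exact: fast_level_shift sE hl.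
have hs : maxmod_to_infty f s by apply/(to_infty_shift l); rewrite sE.
by split=> //; exact: to_infty_gt0 hs.
Qed.

(** Each condition M^n(r) <= |f^n(z)| is closed in r because M^n is continuous, and n = 0 bounds r
    by |z|; hence the supremum is attained. *)
Lemma R_A_max z : fast_escaping f z -> [/\ admissible f (R_A f z),
  fast_level f (R_A f z) z &
  forall r, admissible f r -> fast_level f r z -> r <= R_A f z].
Proof.
move=> Az; pose E := [set r | admissible f r /\ fast_level f r z].
have [r ar lr] := (fast_escapingP z).1 Az.
have Er : E r by [].
have sE : has_sup E.
  by split; [exists r|exists (cmod z) => s [_ /(_ 0%N)]].
have rs : r <= sup E by apply: (ub_le_sup sE.2).
have [r0 hr] := ar.
have s0 : 0 < sup E by lra.
have Es : E (sup E).
  split; first by split=> //; apply: to_infty_le hr => //; exact: ltW.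
  move=> n; rewrite leNgt; apply/negP => bad.
  pose e := iter n M (sup E) - cmod (iter n f z).
  have e0 : 0 < e by rewrite subr_gt0.
  have /contP/(_ _ e0)[d d0 hd] := @iter_maxmod_cont n _ (ltW s0).
  have [x [[x0 hx] lx] xd] := sup_adherent d0 sE.
  have xs : x <= sup E by apply: (ub_le_sup sE.2).
  have := lx n; have := hd x; rewrite ltr_norml ltr_norml /e => /(_ _)/andP[]; last lra.
  by apply/andP; split; lra.
have RE : R_A f z = sup E.
  rewrite /R_A asboolT//; apply: set_max_eq => // x Ex; exact: (ub_le_sup sE.2).
by rewrite RE; split; [exact: Es.1|exact: Es.2|move=> x ax lx; apply: (ub_le_sup sE.2)].
Qed.

Lemma R_A_out z : ~ fast_escaping f z -> R_A f z = R_f f.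
Proof. by move=> h; rewrite /R_A asboolF. Qed.

Lemma fast_level_logP t z : fast_level f (expR t) z <->
  forall n, expR (iter n phi t) <= cmod (iter n f z).
Proof. by split=> h n; have := h n; rewrite iter_logmaxK. Qed.

End FastEscaping.

(** * Chordal limits and the dichotomy on the Fatou set *)

Section Normality.
Variable R : realType.
Local Notation C := (CC R).
Implicit Types (z w p x : C) (r rho : R) (U : set C).

Lemma sqrt1D_le (a : R) : 0 <= a -> Num.sqrt (1 + a ^+ 2) <= 1 + a.
Proof.
move=> a0; have a1 : 0 <= 1 + a by lra.
rewrite -[leRHS]ger0_norm// -sqrtr_sqr ler_wsqrtr//; nra.
Qed.

Lemma sqrt1D_gt0 (a : R) : 0 < Num.sqrt (1 + a ^+ 2).
Proof. by rewrite sqrtr_gt0 ltr_pwDl// sqr_ge0. Qed.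

Lemma chordal_infty_gt (b : R) x : 0 <= b ->
  chordal (Some x) None < 2 / (1 + b) -> b < cmod x.
Proof.
move=> b0; rewrite /= ltr_pM2l// ltf_pV2 ?posrE ?sqrt1D_gt0//; last lra.
by move=> /lt_le_trans/(_ (sqrt1D_le (cmod_ge0 x))); lra.
Qed.

(** If |x| >= 2 |p| + 1, then |x - p| >= |x| / 2 and sqrt (1 + |x|^2) <= 2 |x|, so the chordal
    distance cannot be that small. *)
Lemma chordal_finite_lt x p : chordal (Some x) (Some p) < (2 * (1 + cmod p))^-1 ->
  cmod x < 2 * cmod p + 1.
Proof.
move=> small; rewrite ltNge; apply/negP => big.
move: small; apply/negP; rewrite -leNgt /=.
have p0 := cmod_ge0 p; set a := cmod x in big *.
have a0 : 1 <= a by lra.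
have sx : Num.sqrt (1 + a ^+ 2) <= 2 * a.
  have a20 : 0 <= 2 * a by lra.
  rewrite -[leRHS]ger0_norm// -sqrtr_sqr ler_wsqrtr//; nra.
have xp : a / 2 <= cmod (x - p) by have := cmod_ler_sub x p; rewrite -/a; lra.
have sp := sqrt1D_le p0.
have sx0 := sqrt1D_gt0 a; have sp0 := sqrt1D_gt0 (cmod p).
rewrite ler_pdivlMr ?mulr_gt0// ler_pdivrMl; last lra.
apply: (@le_trans _ _ (2 * a * (1 + cmod p))).
  by apply: ler_pM => //; exact: ltW.
have : (1 + cmod p) * (a / 2) <= (1 + cmod p) * cmod (x - p).
  by rewrite ler_wpM2l//; lra.
lra.
Qed.

Lemma chordal_sym x p : chordal (Some x) (Some p) = chordal (Some p) (Some x).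
Proof. by rewrite /= cmod_subC [Num.sqrt _ * _]mulrC. Qed.

Section LocallyUniformLimit.
Variables (U : set C) (g : nat -> C -> C) (h : C -> option C).
Hypothesis Uo : open U.
Hypothesis gd : forall n w, cdiff (g n) w.
Hypothesis gh : locally_uniform_cvg U g h.

Lemma limit_bounded z p : U z -> h z = Some p ->
  exists N, forall n, (N <= n)%N -> cmod (g n z) < 2 * cmod p + 1.
Proof.
move=> Uz hz; have [V [nV hV]] := gh Uz.
have e0 : 0 < (2 * (1 + cmod p))^-1.
  by rewrite invr_gt0 mulr_gt0// ltr_pwDl// cmod_ge0.
have [N _ hN] := hV _ e0; exists N => n Nn.
have := hN n Nn z Uz (nbhs_singleton nV); rewrite hz; exact: chordal_finite_lt.
Qed.

Lemma limit_infty z b : U z -> h z = None ->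
  exists N, forall n, (N <= n)%N -> b < cmod (g n z).
Proof.
move=> Uz hz; have [V [nV hV]] := gh Uz.
have b0 := normr_ge0 b.
have e0 : 0 < 2 / (1 + `|b|) by rewrite divr_gt0//; lra.
have [N _ hN] := hV _ e0; exists N => n Nn.
have := hN n Nn z Uz (nbhs_singleton nV); rewrite hz => /(chordal_infty_gt b0).
by have := ler_norm b; lra.
Qed.

(** Continuity of h is not at hand, so one function [g N] serves as intermediary. With chordal error
    1/10 it exceeds 19 at z and stays above 7 nearby. If |g n w| <= 1, then h(w) is finite of
    modulus below 3, whence |g N w| < 7, a contradiction. *)
Lemma escape_nbhs z : U z -> h z = None -> exists2 rho, 0 < rho &
  exists N, forall n, (N <= n)%N -> forall w, cmod (w - z) < rho ->
    U w /\ 1 < cmod (g n w).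
Proof.
move=> Uz hz; have [V [nV hV]] := gh Uz.
have e0 : 0 < 1 / 10 :> R by lra.
have [N _ hN] := hV _ e0.
have /nbhs_cmodP[r1 r10 h1] := nV.
have /nbhs_cmodP[r2 r20 h2] : nbhs z U by exact: open_nbhs_nbhs.
have [r3 r30 h3] := (ccontP _ _).1 (cdiff_cont (gd N z)) 1 ltr01.
exists (Num.min r1 (Num.min r2 r3)); first by rewrite !lt_min r10 r20.
exists N => n Nn w; rewrite !lt_min => /and3P[/h1 Vw /h2 Uw /h3 gw].
split=> //; rewrite ltNge; apply/negP => small.
have gN : 19 < cmod (g N z).
  apply: chordal_infty_gt => //; rewrite -hz.
  apply: (lt_le_trans (hN N (leqnn N) z Uz (nbhs_singleton nV))).
  rewrite ler_pdivlMr; lra.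
have gNw : 7 <= cmod (g N w).
  by have := cmod_ler_sub (g N z) (g N w); rewrite cmod_subC; lra.
have := hN n Nn w Uw Vw; have := hN N (leqnn N) w Uw Vw.
have gn0 := cmod_ge0 (g n w).
case: (h w) => [p|] cN cn; last first.
  have k : 1 / 10 <= 2 / (1 + 1) :> R by rewrite ler_pdivlMr; lra.
  have := chordal_infty_gt ler01 (lt_le_trans cn k); lra.
have p3 : cmod p < 3.
  have : cmod p < 2 * cmod (g n w) + 1; last lra.
  apply: chordal_finite_lt; rewrite chordal_sym; apply: (lt_le_trans cn).
  by rewrite div1r lef_pV2 ?posrE//; lra.
have p0 := cmod_ge0 p.
have : cmod (g N w) < 2 * cmod p + 1; last lra.
apply: chordal_finite_lt; apply: (lt_le_trans cN).
by rewrite div1r lef_pV2 ?posrE//; lra.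
Qed.

(** A Hurwitz-type argument: near z eventually |g n| > 1, so log |g n| is positive and Harnack
    transports its divergence from z to w, where a finite limit would keep it bounded. *)
Lemma infty_open z : U z -> h z = None -> exists2 rho, 0 < rho &
  forall w, cmod (w - z) < rho -> h w = None.
Proof.
move=> Uz hz; have [rho rho0 [N hN]] := escape_nbhs Uz hz.
exists rho => // w wrho; case hw : (h w) => [p|//].
have Uw : U w by have [] := hN N (leqnn N) w wrho.
have [N1 hN1] := limit_bounded Uw hw.
pose b := 2 * cmod p + 1.
have b0 : 0 < b by have := cmod_ge0 p; rewrite /b; lra.
set d := cmod (w - z) in wrho.
have d0 : 0 <= d := cmod_ge0 _.
have rd : 0 < rho - d by rewrite subr_gt0.
pose c := (rho + d) * ln b / (rho - d).
have [N2 hN2] := limit_infty (expR c) Uz hz.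
pose n := (N + (N1 + N2))%N.
have n1 : (N <= n)%N by rewrite leq_addr.
have n2 : (N1 <= n)%N by rewrite /n addnCA leq_addr.
have n3 : (N2 <= n)%N by rewrite /n addnA leq_addl.
have := @harnack _ (g n) z rho 0 rho0 (fun w _ => gd n w) _ w wrho.
rewrite expR0 !subr0 -/d => H.
have {}H : (rho - d) * ln (cmod (g n z)) <= (rho + d) * ln (cmod (g n w)).
  by apply: H => w' w'r; have [_ /ltW] := hN n n1 w' w'r.
have gz := hN2 n n3; have gz0 := lt_trans (expR_gt0 c) gz.
have k1 : c < ln (cmod (g n z)) by rewrite -[c]expRK ltr_ln// posrE expR_gt0.
have [_ gw1] := hN n n1 w wrho.
have k2 : ln (cmod (g n w)) <= ln b.
  rewrite ler_ln ?posrE//; last lra.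
  exact/ltW/hN1.
exfalso; have : (rho + d) * ln (cmod (g n w)) <= (rho + d) * ln b.
  by rewrite ler_wpM2l//; lra.
move: k1; rewrite /c ltr_pdivrMr// [ln _ * _]mulrC; lra.
Qed.

Lemma finite_open z p : U z -> h z = Some p -> exists2 rho, 0 < rho &
  forall w, cmod (w - z) < rho -> h w <> None.
Proof.
move=> Uz hz; have [V [nV hV]] := gh Uz.
have p0 := cmod_ge0 p; pose b := 2 * cmod p + 2.
have e0 : 0 < Num.min (2 * (1 + cmod p))^-1 (2 / (1 + b)).
  by rewrite lt_min invr_gt0 divr_gt0 ?mulr_gt0// /b; lra.
have [N _ hN] := hV _ e0.
have /nbhs_cmodP[r1 r10 h1] := nV.
have /nbhs_cmodP[r2 r20 h2] : nbhs z U by exact: open_nbhs_nbhs.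
have [r3 r30 h3] := (ccontP _ _).1 (cdiff_cont (gd N z)) 1 ltr01.
exists (Num.min r1 (Num.min r2 r3)); first by rewrite !lt_min r10 r20.
move=> w; rewrite !lt_min => /and3P[/h1 Vw /h2 Uw /h3 gw] hw.
have gz : cmod (g N z) < 2 * cmod p + 1.
  apply: chordal_finite_lt; rewrite -hz.
  apply: (lt_le_trans (hN N (leqnn N) z Uz (nbhs_singleton nV))).
  by rewrite ge_min lexx.
have := hN N (leqnn N) w Uw Vw; rewrite hw lt_min => /andP[_].
have b0 : 0 <= b by rewrite /b; lra.
move=> /(chordal_infty_gt b0); have := cmod_ler_sub (g N w) (g N z); rewrite /b; lra.
Qed.

(** Along the segment from w0 to w1 the parameters with infinite limit form a nonempty, relatively
    open and closed subset of [0, 1]. *)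
Lemma infty_ball z0 r w0 w1 : (forall w, cmod (w - z0) < r -> U w) ->
  cmod (w0 - z0) < r -> cmod (w1 - z0) < r -> h w0 = None -> h w1 = None.
Proof.
move=> rU w0r w1r hw0.
pose c (t : R) : C := w0 + t%:C * (w1 - w0).
have cr t : 0 <= t <= 1 -> cmod (c t - z0) < r.
  move=> /andP[t0 t1].
  have -> : c t - z0 = ((1 - t)%:C : C) * (w0 - z0) + (t%:C : C) * (w1 - z0).
    by rewrite /c rmorphB /= rmorph1; ring.
  apply: (le_lt_trans (cmodD _ _)); rewrite !cmodM !cmod_real !ger0_norm ?subr_ge0//.
  have [->|t0'] := eqVneq t 0; first by rewrite subr0 mul1r mul0r addr0.
  have tpos : 0 < t by rewrite lt_neqAle eq_sym t0'.
  have k1 : t * cmod (w1 - z0) < t * r by rewrite ltr_pM2l.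
  have k2 : (1 - t) * cmod (w0 - z0) <= (1 - t) * r by rewrite ler_wpM2l ?subr_ge0// ltW.
  lra.
have cc (t e : R) : 0 < e -> exists2 d : R, 0 < d &
    forall s, `|t - s| < d -> cmod (c s - c t) < e.
  move=> e0; exists (e / (cmod (w1 - w0) + 1)).
    by rewrite divr_gt0// ltr_wpDl ?cmod_ge0.
  move=> s; rewrite ltr_pdivlMr ?ltr_wpDl ?cmod_ge0// => ts.
  have -> : c s - c t = ((s - t)%:C : C) * (w1 - w0).
    by rewrite /c rmorphB /=; ring.
  rewrite cmodM cmod_real distrC; have := normr_ge0 (t - s); lra.
(* Openness of P is known only inside the disc, and for t outside [0, 1] the line may leave it;
   hence the extra condition on [c t]. *)
have open_pull (P : C -> Prop) :
    (forall w, cmod (w - z0) < r -> P w -> exists2 rho, 0 < rho &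
       forall w', cmod (w' - w) < rho -> P w') ->
    open [set t | cmod (c t - z0) < r /\ P (c t)].
  move=> Po; rewrite openE => t [ctr Pt].
  have [rho rho0 hrho] := Po _ ctr Pt.
  have e0 : 0 < Num.min rho (r - cmod (c t - z0)) by rewrite lt_min rho0 subr_gt0.
  have [d d0 hd] := cc t _ e0.
  apply/nbhs_ballP; exists d => // s /hd; rewrite lt_min => /andP[k1 k2].
  split; last exact: hrho.
  by have := cmod_tri (c s) z0 (c t); lra.
have /(_ (`[0, 1]%classic `&` [set t | h (c t) = None])) := @segment_connected R 0 1.
move=> E; have : 1 \in (`[0, 1]%classic `&` [set t | h (c t) = None]).
  rewrite E.
  - by apply/mem_set; rewrite /= in_itv/= lexx ler01.
  - by exists 0; split; rewrite /= ?in_itv/= ?lexx ?ler01// /c mul0r addr0.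
  - exists [set t | cmod (c t - z0) < r /\ h (c t) = None].
      by apply: (open_pull (fun w => h w = None)) => w wr; apply: infty_open; exact: rU.
    apply/seteqP; split=> t /= [t01 ht]; split=> //; last by case: ht.
    by split=> //; apply: cr; move: t01; rewrite in_itv.
  - exists (~` [set t | cmod (c t - z0) < r /\ h (c t) <> None]).
      apply: open_closedC; apply: (open_pull (fun w => h w <> None)) => w wr.
      by case hw : (h w) => [p|]// _; apply: finite_open hw; exact: rU.
    apply/seteqP; split=> t /= [t01 ht]; split=> //; first by case.
    apply: contrapT => hn; apply: ht; split=> //; apply: cr; move: t01; by rewrite in_itv.
move=> /set_mem [_ /=]; rewrite /c mul1r addrC subrK; exact.
Qed.

End LocallyUniformLimit.

Lemma homo_ltn_geid (k : nat -> nat) : {homo k : m n / (m < n)%N} ->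
  forall n, (n <= k n)%N.
Proof.
move=> hk; elim=> [//|n IH]; apply: leq_ltn_trans IH _; exact: hk.
Qed.

Lemma fatou_open (f : C -> C) : open (fatou_set f).
Proof.
rewrite openE => z [U [Uo Uz nU]].
have : nbhs z U by exact: open_nbhs_nbhs.
by apply: filterS => w Uw; exists U.
Qed.

Variable f : C -> C.
Variable fd : forall w, cdiff f w.

(** Otherwise there are points of the half disc and arbitrarily late iterates of modulus at most 1
    there. A convergent subsequence of these iterates has limit infinity at w, hence on the whole
    disc, and compactness of the closed half disc contradicts the choice. The radius is fixed before
    w is given. *)
Lemma uniform_escape z0 : fatou_set f z0 -> exists2 rho, 0 < rho &
  forall w, cmod (w - z0) < rho ->
    (forall b, exists N, forall n, (N <= n)%N -> b <= cmod (iter n f w)) ->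
  exists N, forall n, (N <= n)%N -> forall z, cmod (z - z0) < rho ->
    1 < cmod (iter n f z).
Proof.
move=> [U [Uo Uz nU]].
have /nbhs_cmodP[r r0 hr] : nbhs z0 U by exact: open_nbhs_nbhs.
exists (r / 2); first by rewrite divr_gt0.
move=> w wr wesc; apply: contrapT => hN.
have bad N : exists q : nat * C, [/\ (N <= q.1)%N, cmod (q.2 - z0) < r / 2 &
    cmod (iter q.1 f q.2) <= 1].
  apply: contrapT => h; apply: hN; exists N => n Nn z zr; rewrite ltNge.
  by apply/negP => h'; apply: h; exists (n, z).
pose q N := projT1 (cid (bad N)); have qP N := projT2 (cid (bad N)).
rewrite -/(q _) in qP.
have qP' N : [/\ (N <= (q N).1)%N, cmod ((q N).2 - z0) < r / 2 &
    cmod (iter (q N).1 f (q N).2) <= 1] := qP N.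
have [|k [hk [h lh]]] := nU (fun N => iter (q N).1 f).
  by move=> n; exists (q n).1.
(* The selected iteration numbers need not increase, but the one used at stage n is at least k(n) >=
   n, which is what the escape of w requires. *)
have kn := homo_ltn_geid hk.
pose g n := iter (q (k n)).1 f.
have gd n u : cdiff (g n) u by exact: cdiff_iter.
have hw : h w = None.
  case hw : (h w) => [p|//]; have Uw : U w by apply: hr; lra.
  have [N1 h1] := limit_bounded lh Uw hw.
  have [N2 h2] := wesc (2 * cmod p + 1).
  have := h1 (N1 + N2)%N (leq_addr _ _).
  rewrite ltNge => /negP[]; apply: h2.
  have [a1 _ _] := qP' (k (N1 + N2)%N).
  apply: leq_trans a1; apply: leq_trans (kn _); exact: leq_addl.
have wr' : cmod (w - z0) < r by lra.
have hall z : cmod (z - z0) < r -> h z = None.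
  by move=> zr; exact: (infty_ball Uo gd lh hr wr' zr hw).
have /compact_near_coveringP := @cdisk_compact R z0 (r / 2).
move=> /(_ nat \oo (fun n x => 1 < cmod (g n x)) _) [].
  move=> x /= xr; have xr' : cmod (x - z0) < r by lra.
  have [rho rho0 [N hN']] := escape_nbhs Uo gd lh (hr _ xr') (hall _ xr').
  exists ([set y : C | cmod (y - x) < rho], [set n | (N <= n)%N]).
    split; first by apply/nbhs_cmodP; exists rho.
    by exists N.
  by move=> [y n] [/= yr Nn]; have [] := hN' n Nn y yr.
move=> N _ /(_ N (leqnn N)) /(_ (q (k N)).2) /=.
have [_ a2 a3] := qP' (k N).
by move=> /(_ (ltW a2)); rewrite /g ltNge a3.
Qed.

Variable f0 : f 0 = 0.
Variable ft : ~ exists p : {poly R[i]}, forall z, f z = p.[z].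

Lemma fatou_dichotomy z0 : fatou_set f z0 -> exists2 rho, 0 < rho &
  (forall z, cmod (z - z0) < rho -> ~ fast_escaping f z) \/
  exists2 t, R_f f < expR t &
    forall z, cmod (z - z0) < rho -> fast_level f (expR t) z.
Proof.
move=> Fz; have [rho rho0 hesc] := uniform_escape Fz.
(* For w and z within d of z0, the disc of radius 3d about w stays within rho = 4d of z0 and |z - w|
   < 2d, so Harnack loses the factor 5. *)
pose d := rho / 4; have d0 : 0 < d by rewrite divr_gt0.
exists d => //.
have [h|h] := pselect (forall z, cmod (z - z0) < d -> ~ fast_escaping f z).
  by left.
right.
have [w wd wA] : exists2 w, cmod (w - z0) < d & fast_escaping f w.
  by apply: contrapT => h'; apply: h => z zd zA; apply: h'; exists z.
have [r ar lr] := (fast_escapingP fd f0 ft w).1 wA.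
have [r0 /to_inftyP hr] := ar.
have drho : rho = 4 * d by rewrite /d; lra.
have [|b|N hN] := hesc w.
- lra.
- by have [N hN] := hr b; exists N => n Nn; apply: le_trans (lr n); exact: hN.
have harn n z : (N <= n)%N -> cmod (z - z0) < d ->
    ln (cmod (iter n f w)) <= 5 * ln (cmod (iter n f z)).
  move=> Nn zd.
  have hd3 u : cmod (u - w) < 3 * d -> cmod (u - z0) < rho.
    by move=> uw; have := cmod_tri u z0 w; lra.
  have zw : cmod (z - w) < 2 * d by have := cmod_tri z w z0; rewrite (cmod_subC z0); lra.
  have lnp u : cmod (u - z0) < rho -> 0 < ln (cmod (iter n f u)).
    by move=> ur; apply: ln_gt0; exact: hN.
  have zw3 : cmod (z - w) < 3 * d by lra.
  have d30 : 0 < 3 * d by lra.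
  have := @harnack _ (iter n f) w (3 * d) 0 d30 (fun u _ => cdiff_iter n u fd) _ z zw3.
  rewrite expR0 !subr0 => /(_ _) H.
  have {}H := H (fun u uw => ltW (hN n Nn u (hd3 u uw))).
  have lw : 0 < ln (cmod (iter n f w)) by apply: lnp; lra.
  have lz : 0 < ln (cmod (iter n f z)) by apply: lnp; lra.
  have k1 : d * ln (cmod (iter n f w)) <= (3 * d - cmod (z - w)) * ln (cmod (iter n f w)).
    by rewrite ler_wpM2r ?(ltW lw)//; lra.
  have k2 : (3 * d + cmod (z - w)) * ln (cmod (iter n f z)) <=
      (5 * d) * ln (cmod (iter n f z)).
    by rewrite ler_wpM2r ?(ltW lz)//; lra.
  rewrite -(ler_pM2l d0); lra.
have [T T1 hT] := to_infty_big fd f0 ft.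
(* From time L on, |f^(n+L)(w)| >= M^n(e^(5T)). Dividing the logarithm by 5 leaves M^n(e^T) at z,
   and e^T = M^L(s) identifies s as the common level. *)
have [m hm] := hr (expR (5 * T)).
pose L := maxn m N.
have [s s0 sE] := iter_maxmod_onto fd f0 ft L (expR_ge0 T).
have as' : admissible f s.
  have sT : maxmod_to_infty f s.
    apply/(to_infty_shift f L); rewrite sE; by have [] := hT _ (lexx T).
  by split=> //; exact: (to_infty_gt0 fd f0 s0 sT).
exists (ln s); rewrite lnK ?posrE//; try exact: as'.1.
  exact/(admissibleP fd f0 ft).
move=> z zd; apply: (fast_level_shift fd f0 ft s0 sE) => n.
have nL : (N <= n + L)%N by rewrite (leq_trans (leq_maxr m N))// leq_addl.
have phiT : T <= iter n (logmax f) T /\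
    5 * iter n (logmax f) T <= iter n (logmax f) (5 * T).
  elim: n {nL} => [//|n [IH1 IH2]]; rewrite !iterS.
  have [k1 k2 _] := hT _ IH1; split; first lra.
  by apply: (le_trans k2); exact: (logmax_le fd f0 ft).
have [_ p5] := phiT.
have zr : cmod (z - z0) < rho by lra.
have wr : cmod (w - z0) < rho by lra.
have gz := hN _ nL _ zr; have gw := hN _ nL _ wr.
have fw : expR (iter n (logmax f) (5 * T)) <= cmod (iter (n + L) f w).
  apply: le_trans (lr _); rewrite iterD (iter_logmaxK fd ft).
  by apply: (iter_maxmod_le fd f0 ft); [exact: expR_ge0|apply: hm; exact: leq_maxl].
rewrite -(iter_logmaxK fd ft) -[leRHS]lnK ?posrE; last lra.
rewrite ler_expR.
have := harn _ _ nL zd.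
have : iter n (logmax f) (5 * T) <= ln (cmod (iter (n + L) f w)).
  rewrite -[leLHS]expRK ler_ln// posrE ?expR_gt0//; lra.
lra.
Qed.

End Normality.

(** * Supporting lines of convex functions *)

Section SupportingLine.
Variable R : realType.

Lemma convexR_slope (u : R -> R) y m x : convexR u -> y < m -> m < x ->
  (u m - u y) * (x - m) <= (u x - u m) * (m - y).
Proof.
move=> cu ym mx; have xy : 0 < x - y by lra.
pose l := (m - y) / (x - y).
have l01 : 0 <= l <= 1 by rewrite /l divr_ge0 ?ler_pdivrMr//; lra.
have := cu y x l l01.
have -> : (1 - l) * y + l * x = m by rewrite /l; field; rewrite gt_eqF.
have lE : l * (x - y) = m - y by rewrite /l divfK// gt_eqF.
move=> h; have := ler_wpM2r (ltW xy) h.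
have -> : ((1 - l) * u y + l * u x) * (x - y) =
  u y * (x - y - l * (x - y)) + u x * (l * (x - y)) by ring.
rewrite lE; lra.
Qed.

(** The slope is the supremum of the left difference quotients at m, each of which is at most every
    right one. *)
Lemma convexR_support (u : R -> R) m : convexR u ->
  exists s, forall x, u m + s * (x - m) <= u x.
Proof.
move=> cu; pose E := [set (u m - u y) / (m - y) | y in [set y | y < m]].
have ubE x : m < x -> ubound E ((u x - u m) / (x - m)).
  move=> mx _ [y /= ym <-]; rewrite ler_pdivrMr ?subr_gt0// mulrAC.
  by rewrite ler_pdivlMr ?subr_gt0//; exact: convexR_slope.
have sE : has_sup E.
  split; last by exists ((u (m + 1) - u m) / (m + 1 - m)); apply: ubE; lra.
  by exists ((u m - u (m - 1)) / (m - (m - 1))); exists (m - 1) => //=; lra.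
exists (sup E) => x; have [xm|mx|->] := ltgtP x m; last by rewrite subrr mulr0 addr0.
- have : (u m - u x) / (m - x) <= sup E by apply: (ub_le_sup sE.2); exists x.
  rewrite ler_pdivrMr ?subr_gt0//; lra.
- have : sup E <= (u x - u m) / (x - m) by apply: ge_sup sE.1 _; exact: ubE.
  rewrite ler_pdivlMr ?subr_gt0//; lra.
Qed.

End SupportingLine.

(** * Semicontinuity and mean inequality for tau, then subharmonicity *)

Section Subharmonicity.
Variable R : realType.
Local Notation C := (CC R).
Implicit Types (z w : C) (r : R).
Variable f : C -> C.
Variable fd : forall w, cdiff f w.
Variable f0 : f 0 = 0.
Variable ft : ~ exists p : {poly R[i]}, forall z, f z = p.[z].
Local Notation phi := (logmax f).
Local Notation tau := (fun z => ln (R_A f z)).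

Lemma neg_log_R_A_gt0 z : 0 < R_A f z -> neg_log_R_A f z = (- tau z)%:E.
Proof. by move=> h; rewrite /neg_log_R_A lne_EFin// EFinN. Qed.

Lemma neg_log_R_A_fin z : (neg_log_R_A f z < +oo)%E -> 0 < R_A f z.
Proof.
move=> h; rewrite ltNge; apply/negP => h'; move: h.
by rewrite /neg_log_R_A le0_lneNy//= ?ltxx// lee_fin.
Qed.

Lemma neg_log_R_A_pinfty z : neg_log_R_A f z = +oo%E -> R_A f z <= 0.
Proof.
by move=> h; rewrite leNgt; apply/negP => /neg_log_R_A_gt0; rewrite h.
Qed.

Section Disk.
Variables (z0 : C) (rho t1 : R).
Hypothesis Rt1 : R_f f < expR t1.
Hypothesis disk_fast : forall z, cmod (z - z0) < rho -> fast_level f (expR t1) z.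

Lemma tauP z : cmod (z - z0) < rho -> [/\ 0 < R_A f z, t1 <= tau z,
  forall n, expR (iter n phi (tau z)) <= cmod (iter n f z) &
  forall t, R_f f < expR t -> (forall n, expR (iter n phi t) <= cmod (iter n f z)) ->
    t <= tau z].
Proof.
move=> zr; have at1 := (admissibleP fd f0 ft (expR t1)).2 Rt1.
have Az : fast_escaping f z.
  by apply/(fast_escapingP fd f0 ft); exists (expR t1) => //; exact: disk_fast.
have [aR lR mR] := R_A_max fd f0 ft Az.
have R0 : 0 < R_A f z by case: aR.
have mx t : R_f f < expR t -> fast_level f (expR t) z -> t <= tau z.
  move=> ta tl; rewrite -ler_expR lnK ?posrE//.
  by apply: mR => //; exact/(admissibleP fd f0 ft).
split=> //.
- by apply: mx => //; exact: disk_fast.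
- by apply/(fast_level_logP fd ft); rewrite lnK.
- by move=> t ta tl; apply: mx => //; apply/(fast_level_logP fd ft).
Qed.

Lemma iter_neq0 n z : cmod (z - z0) < rho -> iter n f z != 0.
Proof.
move=> /tauP[_ _ /(_ n) h _]; rewrite -cmod_gt0.
exact: lt_le_trans (expR_gt0 _) h.
Qed.

Lemma tau_ln n z : cmod (z - z0) < rho ->
  iter n phi (tau z) <= ln (cmod (iter n f z)).
Proof.
move=> zr; have [_ _ /(_ n) h _] := tauP zr.
by rewrite -[leLHS]expRK ler_ln ?posrE ?expR_gt0// cmod_gt0 iter_neq0.
Qed.

Lemma tau_harnack z w (rho' := rho - cmod (z - z0)) : cmod (z - z0) < rho ->
  cmod (w - z) < rho' ->
  2 * cmod (w - z) * t1 + (rho' - cmod (w - z)) * tau z <=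
  (rho' + cmod (w - z)) * tau w.
Proof.
move=> zr wr; set d := cmod (w - z) in wr *.
have d0 : 0 <= d := cmod_ge0 _.
have rho'0 : 0 < rho' by rewrite subr_gt0.
have sub u : cmod (u - z) < rho' -> cmod (u - z0) < rho.
  by rewrite /rho' => uz; have := cmod_tri u z0 z; lra.
have wr0 := sub _ wr.
have [_ tz _ _] := tauP zr; have [_ _ _ wmax] := tauP wr0.
(* This is Harnack's constant. The convex combination of t1 and tau(z) with weight c is at least t1,
   hence above the threshold, and is tested as a level at w. *)
pose c := (rho' - d) / (rho' + d).
have den : 0 < rho' + d by lra.
have cE : c * (rho' + d) = rho' - d by rewrite /c divfK// gt_eqF.
have c0 : 0 <= c by rewrite divr_ge0//; lra.
have c1 : c <= 1 by rewrite ler_pdivrMr//; lra.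
have : (1 - c) * t1 + c * tau z <= tau w.
  apply: wmax => [|n].
    apply: (lt_le_trans Rt1); rewrite ler_expR.
    have := ler_wpM2l c0 tz; lra.
  have c01 : 0 <= c <= 1 by rewrite c0.
  rewrite -[leRHS]lnK ?posrE ?cmod_gt0 ?iter_neq0// ler_expR.
  apply: (le_trans (iter_logmax_convex fd f0 ft n _ _ c01)).
  have := @harnack _ (iter n f) z rho' (iter n phi t1) rho'0
    (fun u _ => cdiff_iter n u fd) _ w wr.
  rewrite -/d => H.
  have {}H := H (fun u ur =>
    ((fast_level_logP fd ft t1 u).1 (disk_fast (sub u ur))) n).
  have tn := tau_ln n zr.
  have k := ler_wpM2l (_ : 0 <= rho' - d) tn.
  have {}k := k (ltW _); rewrite subr_gt0 in k; have {}k := k wr.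
  rewrite -(ler_pM2r den) mulrDl -mulrA.
  have -> : (1 - c) * (iter n phi t1 * (rho' + d)) =
    iter n phi t1 * (rho' + d - c * (rho' + d)) by ring.
  have -> : c * iter n phi (tau z) * (rho' + d) =
    iter n phi (tau z) * (c * (rho' + d)) by ring.
  rewrite cE; lra.
move=> h; have := ler_wpM2l (ltW den) h.
have -> : (rho' + d) * ((1 - c) * t1 + c * tau z) =
  t1 * (rho' + d - c * (rho' + d)) + tau z * (c * (rho' + d)) by ring.
rewrite cE; lra.
Qed.

Lemma tau_lsc z (e : R) : cmod (z - z0) < rho -> 0 < e ->
  exists2 d : R, 0 < d & forall w, cmod (w - z) < d ->
    cmod (w - z0) < rho /\ tau z - e < tau w.
Proof.
move=> zr e0; pose rho' := rho - cmod (z - z0).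
have rho'0 : 0 < rho' by rewrite subr_gt0.
have [_ tz _ _] := tauP zr.
pose D := tau z - t1.
have D0 : 0 <= D by rewrite subr_ge0.
(* By [tau_harnack] the claim reduces to 2 d D < (rho' + d) e with d = |w - z|; the summand 1 covers
   D = 0. *)
pose del := rho' * e / (2 * (D + 1)).
have D1 : 0 < 2 * (D + 1) by lra.
have del0 : 0 < del by rewrite divr_gt0// mulr_gt0.
have delE : del * (2 * (D + 1)) = rho' * e by rewrite divfK// gt_eqF.
exists (Num.min rho' del); first by rewrite lt_min rho'0.
move=> w; rewrite lt_min => /andP[wr wd]; split.
  by have := cmod_tri w z0 z; rewrite /rho' in wr; lra.
have d0 := cmod_ge0 (w - z).
have := tau_harnack zr wr; rewrite -/rho'; set d := cmod (w - z) in wr wd d0 *.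
move=> h; have den : 0 < rho' + d by lra.
rewrite -(ltr_pM2l den); apply: lt_le_trans h.
have k1 : d * (2 * (D + 1)) < rho' * e by rewrite -delE ltr_pM2r.
have k2 : 0 <= d * e by rewrite mulr_ge0// ltW.
have tE : tau z = t1 + D by rewrite /D addrC subrK.
rewrite tE; lra.
Qed.

(** Lower semicontinuity already gives measurability. Boundedness comes from t1 <= tau on one side
    and, at n = 0, from e^tau <= |w| on the other. *)
Lemma cint_tau r : 0 < r < rho -> cint tau z0 r.
Proof.
move=> /andP[r0 rrho].
have cr t : cmod (circ z0 r t - z0) < rho by rewrite cmod_circ// ltW.
pose B := `|t1| + (cmod z0 + r).
apply: le_integrable (int_cst_integrable 0 (2 * pi) B) => //.
- apply: (@measurable_funS _ _ _ _ setT) => //.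
  apply: lower_semicontinuous_measurable => t a; rewrite lte_fin => at_.
  have e0 : 0 < tau (circ z0 r t) - a by rewrite subr_gt0.
  have [d d0 hd] := tau_lsc (cr t) e0.
  have /cont_cplxP/(_ _ d0)[d' d'0 hd'] := @circ_cont _ z0 r t.
  exists [set s | `|s - t| < d'].
    by apply/nbhs_ballP; exists d' => // s; rewrite /ball/= distrC.
  move=> s /= /hd' /hd[_]; rewrite lte_fin; lra.
- move=> t _; rewrite !abse_EFin lee_fin.
  have [R0 k1 /(_ 0%N) /= k2 _] := tauP (cr t).
  have k3 := cmod_ler_sub (circ z0 r t) z0; rewrite cmod_circ ?(ltW r0)// in k3.
  have k4 := expR_ge1Dx (tau (circ z0 r t)).
  have z00 := cmod_ge0 z0; have := ler_norm (- t1); rewrite normrN => k5.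
  have B0 : 0 <= B by rewrite addr_ge0// addr_ge0// ltW.
  rewrite (ger0_norm B0) ler_norml /B; apply/andP; split; have := normr_ge0 t1; lra.
Qed.

Lemma tau_mean r : 0 < r < rho -> cmean tau z0 r <= tau z0.
Proof.
move=> /[dup] rr /andP[r0 rrho]; have ti := cint_tau rr.
have z0r : cmod (z0 - z0) < rho by rewrite subrr cmod0; lra.
have wr w : cmod (w - z0) = r -> cmod (w - z0) < rho by move=> ->.
have [_ _ _ tmax] := tauP z0r.
set m := cmean tau z0 r.
(* Maximality of tau(z0) only compares levels above [R_f], so m must first be placed there. *)
have mt1 : t1 <= m.
  rewrite -(cmean_cst t1 z0 r); apply: le_cmean; first exact: ltW.
  - exact: cint_cst.
  - exact: ti.
  - by move=> w /wr /tauP[].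
apply: tmax => [|n]; first by apply: (lt_le_trans Rt1); rewrite ler_expR.
(* Jensen through a supporting line at m: its composition with tau has mean phi^n(m), so phi^n(tau)
   itself is never integrated. *)
have [s hs] := convexR_support m (iter_logmax_convex fd f0 ft n).
rewrite -[leRHS]lnK ?posrE ?cmod_gt0 ?iter_neq0// ler_expR.
set u := iter n phi in hs *.
have li : cint (fun w => ln (cmod (iter n f w))) z0 r.
  apply: cint_cont => t; apply: cont_ln_cmod; first exact: ltW.
    by move=> w _; apply/cdiff_cont; exact: cdiff_iter.
  by move=> w /wr; exact: iter_neq0.
rewrite -(mean_value_ln rr); last 2 first.
- by move=> w _; exact: cdiff_iter.
- by move=> w; exact: iter_neq0.
have si := cintZ s ti.
have ci := cint_cst (u m - s * m) z0 r.
have -> : u m = cmean (fun w => (u m - s * m) + s * tau w) z0 r.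
  by rewrite cmeanD// cmean_cst cmeanZ// -/m subrK.
apply: le_cmean; first exact: ltW.
- exact: (cintD ci si).
- exact: li.
- move=> w /wr wr'; apply: le_trans (tau_ln n wr').
  by have := hs (tau w); rewrite /u; lra.
Qed.

Lemma neg_log_R_A_submean r : 0 < r < rho ->
  (neg_log_R_A f z0 <= circle_mean (neg_log_R_A f) z0 r)%E.
Proof.
move=> /[dup] rr /andP[r0 rrho]; have ti := cint_tau rr.
have z0r : cmod (z0 - z0) < rho by rewrite subrr cmod0; lra.
have Ni := cintZ (-1) ti.
have -> : circle_mean (neg_log_R_A f) z0 r = (cmean (fun w => -1 * tau w) z0 r)%:E.
  rewrite /circle_mean /cmean EFinM /Rintegral fineK; last exact: integrable_fin_num.
  congr (_ * _)%E; apply: eq_integral => t _.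
  have cr : cmod (circ z0 r t - z0) < rho by rewrite cmod_circ// ltW.
  rewrite -/(circ z0 r t) neg_log_R_A_gt0; first by rewrite mulN1r.
  by have [] := tauP cr.
rewrite neg_log_R_A_gt0; last by have [] := tauP z0r.
rewrite lee_fin cmeanZ// mulN1r lerN2; exact: tau_mean.
Qed.

End Disk.

Lemma circle_mean_const (u : C -> \bar R) z r (k : R) : 0 <= r ->
  (forall w, cmod (w - z) = r -> u w = k%:E) -> circle_mean u z r = k%:E.
Proof.
move=> r0 uk; rewrite /circle_mean (eq_integral (EFin \o (fun=> k))); last first.
  by move=> t _; rewrite -/(circ z r t) uk// cmod_circ.
have ki := int_cst_integrable 0 (2 * pi) k.
have := cmean_cst k z r; rewrite /cmean /Rintegral => kE.
by rewrite -[in RHS]kE EFinM fineK//; exact: integrable_fin_num.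
Qed.

End Subharmonicity.

Unset Implicit Arguments.

Theorem theorem6p3 (R : realType) (f : CC R -> CC R)
    (f_te : transcendental_entire f) (f0 : f 0 = 0) :
  subharmonic_or_infty (fatou_set f) (neg_log_R_A f).
Proof.
have [fe ft] := f_te.
have fd w : cdiff f w := derivable_cdiff (fe w).
have Fo := @fatou_open R f.
have z00 (z : CC R) : cmod (z - z) = 0 by rewrite subrr cmod0.
have ball_nbhs (z : CC R) (r : R) : 0 < r -> nbhs z [set w | cmod (w - z) < r].
  by move=> r0; apply/nbhs_cmodP; exists r.
have nbhsF z : fatou_set f z -> nbhs z (fatou_set f).
  by move=> Fz; exact: open_nbhs_nbhs.
(* In the first alternative of the dichotomy the function is constant near z, and every condition
   becomes trivial there. *)
have same z rho : 0 < rho ->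
    (forall w, cmod (w - z) < rho -> ~ fast_escaping f w) ->
    forall w, cmod (w - z) < rho -> neg_log_R_A f w = neg_log_R_A f z.
  by move=> rho0 h w wr; rewrite /neg_log_R_A !R_A_out//; apply: h; rewrite // z00.
split.
  rewrite openE => z [Fz vz]; have [rho rho0 hz] := fatou_dichotomy fd f0 ft Fz.
  have : nbhs z (fatou_set f `&` [set w | cmod (w - z) < rho]).
    by apply: filterI; [exact: nbhsF|exact: ball_nbhs].
  apply: filterS => w [Fw wr]; split=> //=.
  (* The second alternative cannot occur at an infinite value, since it makes [R_A] positive. *)
  case: hz => [h|[t Rt h]]; first by rewrite (same z rho).
  have zr : cmod (z - z) < rho by rewrite z00.
  have [R0 _ _ _] := tauP fd f0 ft Rt h zr.
  by have := neg_log_R_A_pinfty vz; rewrite leNgt R0.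
have wfin z t rho : R_f f < expR t ->
    (forall w, cmod (w - z) < rho -> fast_level f (expR t) w) ->
    forall w, cmod (w - z) < rho -> (neg_log_R_A f w < +oo)%E.
  move=> Rt h w wr; have [R0 _ _ _] := tauP fd f0 ft Rt h wr.
  by rewrite neg_log_R_A_gt0// ltry.
split.
- rewrite openE => z [Fz vz]; have [rho rho0 hz] := fatou_dichotomy fd f0 ft Fz.
  have : nbhs z (fatou_set f `&` [set w | cmod (w - z) < rho]).
    by apply: filterI; [exact: nbhsF|exact: ball_nbhs].
  apply: filterS => w [Fw wr]; split=> //=.
  case: hz => [h|[t Rt h]]; first by rewrite (same z rho).
  exact: (wfin z t rho).
- by move=> z [].
- move=> z [Fz vz] a vza; have [rho rho0 hz] := fatou_dichotomy fd f0 ft Fz.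
  case: hz => [h|[t Rt h]].
    apply: filterS (ball_nbhs z _ rho0) => w wr.
    by rewrite (same z rho).
  have zr : cmod (z - z) < rho by rewrite z00.
  have [R0 _ _ _] := tauP fd f0 ft Rt h zr.
  rewrite neg_log_R_A_gt0// lte_fin in vza.
  (* This is the gap between a and the value at z; lower semicontinuity of tau with this margin
     gives -tau(w) < a. *)
  have e0 : 0 < ln (R_A f z) + a by lra.
  have [d d0 hd] := tau_lsc fd f0 ft Rt h zr e0.
  apply: filterS (ball_nbhs z _ d0) => w /hd[wr tw].
  have [Rw _ _ _] := tauP fd f0 ft Rt h wr.
  by rewrite neg_log_R_A_gt0// lte_fin; lra.
- move=> z [Fz vz]; have [rho rho0 hz] := fatou_dichotomy fd f0 ft Fz.
  exists rho; split=> // r rr; case: hz => [h|[t Rt h]]; last first.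
    exact: (neg_log_R_A_submean fd f0 ft Rt h rr).
  have R0 := neg_log_R_A_fin vz.
  have vE := neg_log_R_A_gt0 R0.
  have [r0 rrho] := andP rr.
  rewrite (@circle_mean_const _ _ z r (- ln (R_A f z))) ?vE ?(ltW r0) ?lexx// => w wr.
  by rewrite (same z rho) ?vE// wr.
Qed.
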